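(* Let $f:\mathbb{N}\to\mathbb{N}$ be any increasing function. Then there exists a residual subset $G$ of $\mathcal{X}$ (with the weak topology) such that every element of $G$ has an $f$-thick mixing sequence.
   Context: $\lambda$ denotes Lebesgue measure. $\mathcal{X}$ is the set of all bimeasurable (i.e. invertible, measurable with measurable inverse) transformations $T:[0,1]\to[0,1]$ that preserve $\lambda$, modulo the equivalence relation $T\sim S$ iff $Tx=Sx$ for $\lambda$-almost every $x$. The weak topology on $\mathcal{X}$ is the topology generated by the sets $N(T,A,\epsilon)=\{S\in\mathcal{X}: \lambda(SA\,\Delta\, TA)<\epsilon\}$, where $T\in\mathcal{X}$, $A\subset[0,1)$ is measurable and $\epsilon>0$; it makes $\mathcal{X}$ a Polish space. Residual means containing a dense $G_\delta$ set. A sequence of natural numbers $a_1<a_2<\dots$ is a mixing sequence for $T$ if for any measurable sets $A,B$ we have $\lim_{i\to\infty}\lambda(T^{-a_i}A\cap B)=\lambda(A)\lambda(B)$. Given an increasing function $f:\mathbb{N}\to\mathbb{N}$, an increasing sequence of natural numbers $a_1<a_2<\dots$ is $f$-thick if $[j,f(j)]\subset\{a_i\}_{i=1}^\infty$ for infinitely many $j$, where $[j,f(j)]$ denotes the integers between $j$ and $f(j)$ inclusive. *)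

(* Defs.v *)
From HB Require Import structures.
From mathcomp Require Import all_boot all_order all_algebra.
From mathcomp Require Import all_classical all_reals all_analysis.
From mathcomp Require Import borel_hierarchy.

Set Implicit Arguments.
Unset Strict Implicit.
Unset Printing Implicit Defensive.

Import Order.TTheory GRing.Theory Num.Theory.
Import numFieldNormedType.Exports.

Local Open Scope classical_set_scope.
Local Open Scope ring_scope.

Local Notation lambda := (@lebesgue_measure _).

Definition unit_itv (R : realType) : set R := [set` `[0, 1]].
Arguments unit_itv {R}.

(* A map [0,1] -> [0,1] is encoded by a map R -> R whose values outside [0,1]
   are irrelevant: they are not constrained here, and are forgotten by the
   quotient below.  Measurability is the library's, i.e. Borel measurability. *)
Definition bimeasurable (R : realType) (T : R -> R) :=
  [/\ set_fun unit_itv unit_itv T, measurable_fun unit_itv T &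
      exists U : R -> R,
        [/\ set_fun unit_itv unit_itv U, measurable_fun unit_itv U,
            {in unit_itv, cancel T U} & {in unit_itv, cancel U T}]].

Definition preserves_lambda (R : realType) (T : R -> R) :=
  forall A : set R, measurable A -> A `<=` unit_itv ->
    lambda (unit_itv `&` T @^-1` A) = lambda A.

Record transformation (R : realType) := Transformation {
  transformation_fun :> R -> R ;
  transformation_bimeasurable : bimeasurable transformation_fun ;
  transformation_preserves : preserves_lambda transformation_fun }.

HB.instance Definition _ (R : realType) := gen_eqMixin (transformation R).
HB.instance Definition _ (R : realType) := gen_choiceMixin (transformation R).

Section quotient.
Variable R : realType.

Definition ae_eq_transformation (T S : transformation R) :=
  `[< ae_eq lambda unit_itv T S >].

Lemma ae_eq_transformation_refl : reflexive ae_eq_transformation.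
Proof. by move=> T; apply/asboolP; exact: ae_eq_refl. Qed.

Lemma ae_eq_transformation_sym : symmetric ae_eq_transformation.
Proof.
by move=> T S; apply/idP/idP => /asboolP h; apply/asboolP; exact: ae_eq_sym.
Qed.

Lemma ae_eq_transformation_trans : transitive ae_eq_transformation.
Proof.
by move=> S T U /asboolP TS /asboolP SU; apply/asboolP; exact: ae_eq_trans TS SU.
Qed.

Canonical ae_eq_transformation_equiv :=
  EquivRel ae_eq_transformation ae_eq_transformation_refl
    ae_eq_transformation_sym ae_eq_transformation_trans.

Local Open Scope quotient_scope.

Definition mptrans : Type := {eq_quot ae_eq_transformation}.
HB.instance Definition _ := Choice.on mptrans.
HB.instance Definition _ := EqQuotient.on mptrans.

(* Images of sets under a.e. equal transformations differ by null sets, so this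
   depends neither on the representative T nor on the representatives S. *)
Definition weak_nbhd (T : transformation R) (A : set R) (e : R) : set mptrans :=
  [set \pi_mptrans S | S in
    [set S : transformation R | (lambda ((S @` A) `+` (T @` A)) < e%:E)%E]].

Definition weak_subbase : set (set mptrans) :=
  [set N | exists (T : transformation R) (A : set R) (e : R),
    [/\ measurable A, A `<=` `[0, 1[, 0 < e & N = weak_nbhd T A e]].

HB.instance Definition _ := isSubBaseTopological.Build mptrans weak_subbase id.

Definition mixing_sequence (a : nat -> nat) (c : mptrans) :=
  forall T : transformation R, \pi_mptrans T = c ->
  forall A B : set R, measurable A -> measurable B ->
    A `<=` unit_itv -> B `<=` unit_itv ->
    lambda ((iter (a i) T @^-1` A) `&` B) @[i --> \oo]
      --> (lambda A * lambda B)%E.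

End quotient.

Definition residual (X : topologicalType) (G : set X) :=
  exists D : set X, [/\ Gdelta D, dense D & D `<=` G].

Definition increasing_nat (f : nat -> nat) := {homo f : i j / (i < j)%N}.

Definition thick (f a : nat -> nat) :=
  forall n : nat, exists2 j : nat, (n <= j)%N &
    forall k : nat, (j <= k <= f j)%N -> exists i, a i = k.

(* Main.v *)
Require Import Defs.
From mathcomp Require Import all_boot all_order all_algebra.
From mathcomp Require Import perm.
From mathcomp Require Import all_classical all_reals all_analysis.
From mathcomp Require Import measurable_realfun ring lra zify.

(**
No Baire argument is needed.  Call [j] a window of precision [n] for [T] when
every exponent [k] in [j, f(j)] satisfies
[|lambda (D `&` T^k D') - lambda D * lambda D'| < 1/(n+1)] for the finitely many
unions [D], [D'] of dyadic intervals of rank [n].  Having such a window beyond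
[n] is a weakly open condition, and a transformation having one for every [n]
mixes along the union of its windows.  Every mixing transformation satisfies all
these conditions, so it remains to approximate a given [T] by a mixing one.

As in Halmos's theorem, [T] is first approximated by a permutation [P] of the
dyadic intervals of some rank [N].  Then consider the Markov chain on [{0,1}^N]
that moves from [s] to [P s], except that with probability [2^-m] it jumps to a
fresh uniform state.  Its natural extension is realised on two-sided sequences
of fair bits, that is, on binary digits: blocks of [N + m] bits are shifted, and
unless the [m] coin bits of the incoming block vanish, its [N] state bits are
exchanged with the image by [P] of the current state.  Once the coin has fired,
the future no longer depends on the past, hence the map is mixing; and it agrees
with [P] on the first [N] digits outside a set of measure [2^-m].
*)

Set Implicit Arguments.
Unset Strict Implicit.
Unset Printing Implicit Defensive.

Import Order.TTheory GRing.Theory Num.Theory.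
Import numFieldNormedType.Exports.

Local Open Scope classical_set_scope.
Local Open Scope ring_scope.
Local Open Scope quotient_scope.

Local Notation lambda := (@lebesgue_measure _).

(** * Binary digits *)

Local Notation bits := (nat -> bool).

Definition agree n (b b' : bits) := forall i, (i < n)%N -> b i = b' i.

(** The sequences that are not eventually one. By [many_zeros_digit] and [bvalK] they are exactly
    the greedy digit sequences of the points of [[0,1)]. *)
Definition many_zeros (b : bits) := forall n, exists2 k, (n <= k)%N & b k = false.

Definition restr n (b : bits) : {ffun 'I_n -> bool} := [ffun i : 'I_n => b i].

Definition extend n (v : {ffun 'I_n -> bool}) : bits :=
  fun k => oapp v false (insub k).

Lemma extend_ord n (v : {ffun 'I_n -> bool}) (i : 'I_n) : extend v i = v i.
Proof. by rewrite /extend valK. Qed.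

Lemma extendK n : cancel (@extend n) (restr n).
Proof. by move=> v; apply/ffunP => i; rewrite ffunE extend_ord. Qed.

Lemma agree_extend n b : agree n (extend (restr n b)) b.
Proof. by move=> i ltin; rewrite (extend_ord _ (Ordinal ltin)) ffunE. Qed.

Lemma agree_restr n b b' : agree n b b' <-> restr n b = restr n b'.
Proof.
split=> [bb'|/ffunP bb' i ltin]; first by apply/ffunP => i; rewrite !ffunE bb'.
by have := bb' (Ordinal ltin); rewrite !ffunE.
Qed.

Lemma agree_sym n b b' : agree n b b' -> agree n b' b.
Proof. by move=> bb' i /bb'. Qed.

Lemma agree_le m n b b' : (m <= n)%N -> agree n b b' -> agree m b b'.
Proof. by move=> lemn bb' i ltim; apply: bb'; exact: leq_trans lemn. Qed.

Definition determined n (p : bits -> bool) :=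
  forall b b', agree n b b' -> p b = p b'.

Lemma determined_le m n p : (m <= n)%N -> determined m p -> determined n p.
Proof. by move=> lemn dp b b' /(agree_le lemn); exact: dp. Qed.

Section digits.
Variable R : realType.
Implicit Types (x y : R) (b : bits).

Local Notation h := (2^-1 : R).

Lemma hX_gt0 n : 0 < h ^+ n. Proof. by rewrite exprn_gt0// invr_gt0. Qed.

Lemma hXS n : h ^+ n = h ^+ n.+1 + h ^+ n.+1.
Proof. by rewrite exprS; lra. Qed.

Lemma hX_lt (e : R) : 0 < e -> exists n, h ^+ n < e.
Proof.
move=> e0; have : (h ^+ n @[n --> \oo] --> (0 : R)).
  by apply: cvg_expr; rewrite ger0_norm ?invr_ge0// invf_lt1// ltr1n.
move=> /cvgr0_norm_lt /(_ _ e0) [N _ HN]; exists N.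
by have := HN N (leqnn _); rewrite /= ger0_norm// ltW// hX_gt0.
Qed.

Lemma hX_le m n : (m <= n)%N -> h ^+ n <= h ^+ m.
Proof.
by move=> lemn; apply: ler_wiXn2l => //; rewrite ?invr_ge0// invf_le1// ler1n.
Qed.

Lemma mul_bit (c : bool) (y : R) : c%:R * y = if c then y else 0.
Proof. by case: c; rewrite ?mul1r ?mul0r. Qed.

Fixpoint psum b n : R :=
  if n is m.+1 then psum b m + (b m)%:R * h ^+ m.+1 else 0.

(** Greedy truncation: a power of one half is added whenever the sum stays at most [x]. The
    non-strict test selects, at dyadic points of [[0,1)], the expansion ending in zeros. *)
Fixpoint approx x n : R :=
  if n is m.+1 then
    approx x m + (approx x m + h ^+ m.+1 <= x)%R%:R * h ^+ m.+1
  else 0.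

Definition digit x : bits := fun n => approx x n + h ^+ n.+1 <= x.

Lemma approxE x n : approx x n = psum (digit x) n.
Proof. by elim: n => //= n <-. Qed.

Lemma psum_digit x n : 0 <= x < 1 ->
  psum (digit x) n <= x < psum (digit x) n + h ^+ n.
Proof.
move=> x01; elim: n => [|n /andP[lo hi]]; first by rewrite add0r expr0.
rewrite /= mul_bit; have E : digit x n = (psum (digit x) n + h ^+ n.+1 <= x).
  by rewrite -approxE.
rewrite E; case: (leP (psum (digit x) n + h ^+ n.+1) x) => cmp.
  by rewrite cmp/= -addrA -hXS.
by rewrite addr0 lo.
Qed.

Lemma psum_agree b b' n : agree n b b' -> psum b n = psum b' n.
Proof.
elim: n => //= n IH bb'; rewrite IH ?(bb' n)//.
exact: agree_le bb'.
Qed.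

Lemma psumS b n : psum b n.+1 = psum b n + (b n)%:R * h ^+ n.+1.
Proof. by []. Qed.

(** The dyadic interval of rank [n.+1] is one half of that of rank [n]; which half it is decides the
    bit [n]. *)
Lemma agree_digit b x n :
  psum b n <= x < psum b n + h ^+ n -> agree n (digit x) b.
Proof.
elim: n => [_ i|n IH]; first by rewrite ltn0.
have h0 := hX_gt0 n.+1; have hS := hXS n.
rewrite psumS mul_bit => /andP[lo hi].
have agn : agree n (digit x) b.
  apply: IH; apply/andP; split; case: (b n) lo hi => lo hi; lra.
move=> i; rewrite ltnS leq_eqVlt => /orP[/eqP ->|/agn//].
rewrite /digit approxE (psum_agree agn).
by case: (b n) lo hi => lo hi; [apply/idP|apply/negbTE; rewrite -ltNge]; lra.
Qed.

Lemma agree_digits_dist x y n : 0 <= x < 1 -> 0 <= y < 1 ->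
  agree n (digit x) (digit y) -> `|x - y| < h ^+ n.
Proof.
move=> /(psum_digit n)/andP[xl xr] /(psum_digit n)/andP[yl yr] /psum_agree xy.
by rewrite ltr_norml; apply/andP; split; lra.
Qed.

Lemma digit_inj x y : 0 <= x < 1 -> 0 <= y < 1 -> digit x = digit y -> x = y.
Proof.
move=> x01 y01 xy; apply/eqP; rewrite -subr_eq0 -normr_eq0; apply: contraT => n0.
have [n hn] := @hX_lt `|x - y| ltac:(by rewrite lt_neqAle eq_sym n0 normr_ge0).
have : `|x - y| < h ^+ n by apply: agree_digits_dist => //; rewrite xy.
by move/(lt_trans hn); rewrite ltxx.
Qed.

Lemma psum_le b m n : (m <= n)%N -> psum b m <= psum b n.
Proof.
move=> /subnK <-; elim: (n - m)%N => //= k IH; apply: le_trans IH _.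
by rewrite lerDl mulr_ge0// ltW// hX_gt0.
Qed.

Lemma psum_ub b m n : (m <= n)%N -> psum b n <= psum b m + h ^+ m - h ^+ n.
Proof.
move=> /subnK <-; elim: (n - m)%N => [|k IH]; first by rewrite add0n addrK.
rewrite addSn psumS mul_bit; have := hXS (k + m); have := hX_gt0 (k + m).+1.
by case: (b _); lra.
Qed.

(** A zero at position [k] forgoes [h ^+ k.+1] for good, even if all later bits are ones. This makes
    the upper bound in [bval_itv] strict. *)
Lemma psum_zero b m k : (m <= k)%N -> b k = false ->
  forall n, psum b n <= psum b m + h ^+ m - h ^+ k.+1.
Proof.
move=> lemk bk0 n; apply: (@le_trans _ _ (psum b (maxn n k.+1))).
  by apply: psum_le; rewrite leq_maxl.
apply: le_trans (psum_ub _ (leq_maxr n k.+1)) _.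
have := psum_ub b lemk; rewrite psumS mul_bit bk0 ?addr0.
have := hX_gt0 (maxn n k.+1); have := hXS k; lra.
Qed.

(** If all digits from [n] on were ones, the partial sums would tend to [psum (digit x) n + h ^+ n],
    which is strictly above [x], while each of them is at most [x]. *)
Lemma many_zeros_digit x : 0 <= x < 1 -> many_zeros (digit x).
Proof.
move=> x01 n; apply: contrapT => no0.
have ones k : (n <= k)%N -> digit x k.
  by move=> lenk; apply: contrapT => /negP/negbTE dk; apply: no0; exists k.
have E k : psum (digit x) (k + n) = psum (digit x) n + h ^+ n - h ^+ (k + n).
  elim: k => [|k IH]; first by rewrite add0n addrK.
  by rewrite addSn psumS mul_bit ones ?leq_addl// IH; have := hXS (k + n); lra.
have /andP[_] := psum_digit n x01.
rewrite -subr_gt0 => /hX_lt[m hm].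
have /andP[+ _] := psum_digit (m + n) x01; rewrite E.
have : h ^+ (m + n) <= h ^+ m by rewrite hX_le// leq_addr.
lra.
Qed.

Definition bval b : R := sup (range (psum b)).

Lemma bval_itv b n : many_zeros b -> psum b n <= bval b < psum b n + h ^+ n.
Proof.
move=> /(_ n)[k lenk bk0].
have ub : ubound (range (psum b)) (psum b n + h ^+ n - h ^+ k.+1).
  by move=> _ [m _ <-]; exact: psum_zero.
apply/andP; split.
  by apply: ub_le_sup; [exists (psum b n + h ^+ n - h ^+ k.+1)|exists n].
apply: (@le_lt_trans _ _ (psum b n + h ^+ n - h ^+ k.+1)).
  by apply: ge_sup => //; exists (psum b 0), 0%N.
by rewrite ltrBlDr ltrDl hX_gt0.
Qed.

Lemma bval01 b : many_zeros b -> 0 <= bval b < 1.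
Proof. by move=> /(bval_itv 0); rewrite add0r expr0. Qed.

Lemma bvalK b : many_zeros b -> digit (bval b) = b.
Proof.
move=> b0; apply/funext => i.
exact: (agree_digit (bval_itv i.+1 b0) (ltnSn i)).
Qed.

(** The point 1 is left out, since its greedy digits are all ones; it is a null set. *)
Definition event (p : bits -> bool) : set R := [set x | 0 <= x < 1 /\ p (digit x)].

Lemma event_cylinder n (v : {ffun 'I_n -> bool}) :
  event (fun b => restr n b == v) =
  [set` `[psum (extend v) n, psum (extend v) n + h ^+ n[ ].
Proof.
have e0 : 0 <= psum (extend v) n by exact: (psum_le (extend v) (leq0n n)).
have e1 := psum_ub (extend v) (leq0n n); rewrite /= add0r expr0 in e1.
apply/seteqP; split => x /=; rewrite in_itv /=.
  move=> [x01 /eqP rx]; have := psum_digit n x01.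
  rewrite (@psum_agree (digit x) (extend v))//.
  by apply/agree_restr; rewrite extendK.
move=> xv; split; first by move: xv => /andP[]; lra.
by rewrite -[v in _ == v]extendK; apply/eqP/agree_restr; exact: agree_digit.
Qed.

Lemma event_determined n (p : bits -> bool) : determined n p ->
  event p = \bigcup_(v in [set v | p (extend v)])
              event (fun b => restr n b == v).
Proof.
move=> dp; apply/seteqP; split => x /=.
  move=> [x01 px]; exists (restr n (digit x)) => //=.
  by rewrite (dp _ _ (@agree_extend n (digit x))).
move=> [v /= pv [x01 /eqP rx]]; split => //.
by rewrite -rx (dp _ _ (@agree_extend n (digit x))) in pv.
Qed.

Lemma measurable_cylinder n (v : {ffun 'I_n -> bool}) :
  measurable (event (fun b => restr n b == v)).
Proof. by rewrite event_cylinder; exact: measurable_itv. Qed.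

Lemma measurable_event n p : determined n p -> measurable (event p).
Proof.
move=> /event_determined ->; apply: fin_bigcup_measurable => // v _.
exact: measurable_cylinder.
Qed.

Lemma lambda_event n p : determined n p ->
  lambda (event p) =
  (#|[pred v : {ffun 'I_n -> bool} | p (extend v)]|%:R * h ^+ n)%:E.
Proof.
move=> /event_determined ->; set P := [pred v : {ffun 'I_n -> bool} | p (extend v)].
have -> : [set v : {ffun 'I_n -> bool} | p (extend v)] = [set` enum P].
  by apply/seteqP; split=> v /=; rewrite mem_enum.
rewrite measure_fin_bigcup//; first last.
- by move=> v _; exact: measurable_cylinder.
- by move=> u v _ _ [x [[_ /eqP <-] [_ /eqP]]].
rewrite -fsbig_seq ?enum_uniq//= (eq_bigr (fun=> (h ^+ n)%:E)) => [|v _].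
  by rewrite sumEFin big_const_seq count_predT iter_addr addr0 mulr_natl -cardE.
rewrite event_cylinder lebesgue_measure_itv/= lte_fin ltrDl hX_gt0.
by rewrite -EFinB addrAC subrr add0r.
Qed.
End digits.

(** * Counting bit vectors *)

Lemma card_reindex (T : finType) (t : T -> T) (Q : pred T) :
  injective t -> #|[pred v | Q (t v)]| = #|Q|.
Proof. by move=> t_inj; rewrite -!sum1_card [RHS](reindex_inj t_inj). Qed.

Lemma card_bits n : #|{: {ffun 'I_n -> bool}}| = (2 ^ n)%N.
Proof. by rewrite card_ffun card_bool card_ord. Qed.

(** All fibres of the map [r] reading the coordinates [iota i] have the same size, since exclusive
    or with a fixed vector carries one to another. The identity is cross-multiplied to stay in the
    natural numbers. *)
Lemma card_determined_coord n M (iota : nat -> nat) (p : bits -> bool) :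
  injective iota -> (forall i, (i < n)%N -> (iota i < M)%N) -> determined n p ->
  (#|[pred v : {ffun 'I_M -> bool} | p (extend v \o iota)]| * 2 ^ n =
   #|[pred v : {ffun 'I_n -> bool} | p (extend v)]| * 2 ^ M)%N.
Proof.
move=> iota_inj iotaM dp.
pose r (v : {ffun 'I_M -> bool}) := restr n (extend v \o iota).
(* A preimage of [u] under [r], zero at all other coordinates: adding it translates the fibre over
   [u] to the fibre over zero. *)
pose w (u : {ffun 'I_n -> bool}) : {ffun 'I_M -> bool} :=
  [ffun k : 'I_M => [exists i : 'I_n, (iota i == k) && u i]].
have wE u (i : 'I_n) : extend (w u) (iota i) = u i.
  rewrite (extend_ord _ (Ordinal (iotaM i (ltn_ord i)))) ffunE /=.
  apply/existsP/idP => [[j /andP[/eqP /iota_inj /val_inj -> //]]|ui].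
  by exists i; rewrite eqxx.
pose xor (u v : {ffun 'I_M -> bool}) : {ffun 'I_M -> bool} :=
  [ffun k => u k (+) v k].
have xorK u : injective (xor u).
  move=> v v' /ffunP E; apply/ffunP => k; have := E k; rewrite !ffunE.
  exact: addbI.
have xorE u v k : extend (xor u v) k = extend u k (+) extend v k.
  by rewrite /extend; case: insubP => //= i _ _; rewrite ffunE.
have fiber u : #|[pred v | r v == u]| = #|[pred v | r v == [ffun=> false]]|.
  rewrite -[RHS](card_reindex _ (xorK (w u))); apply: eq_card => v.
  rewrite !inE /r; apply/eqP/eqP => [<-|/ffunP E].
    by apply/ffunP => i; rewrite !ffunE /= xorE wE !ffunE /= addbb.
  apply/ffunP => i; have := E i; rewrite !ffunE /= xorE wE.
  by case: (extend v (iota i)); case: (u i).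
have count (Q : pred {ffun 'I_n -> bool}) :
    #|[pred v | Q (r v)]| = (#|Q| * #|[pred v | r v == [ffun=> false]]|)%N.
  rewrite -sum1_card (partition_big r Q)//= -sum_nat_const.
  apply: eq_bigr => u Qu; rewrite -(fiber u) -sum1_card; apply: eq_bigl => v.
  by rewrite !inE andbC; case: eqP => // ->.
have cM : (2 ^ M = 2 ^ n * #|[pred v | r v == [ffun=> false]]|)%N.
  by rewrite -!card_bits -(count predT); apply: eq_card => v; rewrite !inE.
have -> : #|[pred v : {ffun 'I_M -> bool} | p (extend v \o iota)]| =
          #|[pred v | p (extend (r v))]|.
  by apply: eq_card => v; rewrite !inE; apply/esym/dp/agree_extend.
by rewrite (count [pred u | p (extend u)]) cM -mulnA [(_ * 2 ^ n)%N]mulnC.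
Qed.

(** Exchanging the coordinates outside [J] between two vectors is an involution on pairs. It turns
    [p] of the first vector and [q] of the second into [p] and [q] of the first alone, leaving the
    second free. *)
Lemma card_independent M (J : pred nat) (p q : bits -> bool) :
  (forall b b', (forall k, J k -> b k = b' k) -> p b = p b') ->
  (forall b b', (forall k, ~~ J k -> b k = b' k) -> q b = q b') ->
  (#|[pred v : {ffun 'I_M -> bool} | p (extend v) && q (extend v)]| * 2 ^ M =
   #|[pred v : {ffun 'I_M -> bool} | p (extend v)]| *
   #|[pred v : {ffun 'I_M -> bool} | q (extend v)]|)%N.
Proof.
move=> pJ qJ; pose V := {ffun 'I_M -> bool}.
pose mix (u v : V) : V := [ffun k : 'I_M => if J k then u k else v k].
pose t (uv : V * V) := (mix uv.1 uv.2, mix uv.2 uv.1).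
have t_inj : injective t.
  apply: (can_inj (g := t)) => -[u v]; congr pair; apply/ffunP => k;
  by rewrite /= /mix !ffunE; case: (J k).
have mixE u v k : extend (mix u v) k = if J k then extend u k else extend v k.
  by rewrite /extend; case: insubP => //= [i _ <-|_]; rewrite ?ffunE //; case: ifP.
rewrite -[(2 ^ M)%N]card_bits -!cardX -[RHS](card_reindex _ t_inj).
apply: eq_card => -[u v]; rewrite !inE /= andbT; congr andb.
  by apply: pJ => k Jk; rewrite mixE Jk.
by apply: qJ => k /negbTE Jk; rewrite mixE Jk.
Qed.

(** * The measure of finitary events *)

Section mu.
Variable R : realType.
Implicit Types A B C : set R.

(** Cutting down to the unit interval makes this a real-valued probability on measurable sets, open
    to real arithmetic. *)
Definition mu A : R := fine (lambda (A `&` unit_itv)).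

Lemma measurable_unit_itv : measurable (@unit_itv R).
Proof. exact: measurable_itv. Qed.
Local Hint Resolve measurable_unit_itv : core.

Lemma lambda_unit_itv : lambda (@unit_itv R) = 1%E.
Proof. by rewrite lebesgue_measure_itv/= lte_fin ltr01 oppr0 adde0. Qed.

Lemma lambda_mu A : measurable A -> lambda (A `&` unit_itv) = (mu A)%:E.
Proof.
move=> mA; rewrite fineK// ge0_fin_numE//.
apply: (@le_lt_trans _ _ (lambda (@unit_itv R))).
  by apply: le_measure; rewrite ?inE; [exact: measurableI| |exact: subIsetr].
by rewrite lambda_unit_itv ltry.
Qed.

Lemma lambda_muS A : measurable A -> A `<=` unit_itv -> lambda A = (mu A)%:E.
Proof. by move=> mA AI; rewrite -lambda_mu// setIidl. Qed.

Lemma mu_ge0 A : 0 <= mu A.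
Proof. by rewrite fine_ge0. Qed.

Lemma muID A B : measurable A -> measurable B ->
  mu A = mu (A `&` B) + mu (A `\` B).
Proof.
move=> mA mB; apply: EFin_inj; rewrite EFinD -!lambda_mu//; first last.
- exact: measurableI.
- exact: measurableD.
rewrite -measureU//; first last.
- by apply/seteqP; split => // x [[[_ Bx] _] [[_ nBx] _]].
- by apply: measurableI => //; exact: measurableD.
- by apply: measurableI => //; exact: measurableI.
by rewrite -setIUl setUIDK.
Qed.

Lemma mu_le A B : measurable A -> measurable B -> A `<=` B -> mu A <= mu B.
Proof.
move=> mA mB AB; rewrite -lee_fin -!lambda_mu//.
apply: le_measure; rewrite ?inE; last exact: setSI.
- exact: measurableI.
- exact: measurableI.
Qed.

Lemma mu_leI A B : measurable A -> measurable B -> A `&` unit_itv `<=` B ->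
  mu A <= mu B.
Proof.
move=> mA mB AB; rewrite -lee_fin -!lambda_mu//.
apply: le_measure; rewrite ?inE; [exact: measurableI|exact: measurableI|].
by move=> x xA; split; [exact: AB|exact: xA.2].
Qed.

Lemma mu_set1 (x : R) : mu [set x] = 0.
Proof.
apply/eqP; rewrite eq_le mu_ge0 andbT -lee_fin -lambda_mu//.
apply: (@le_trans _ _ (lambda [set x])); last by rewrite lebesgue_measure_set1.
by apply: le_measure; rewrite ?inE//; exact: measurableI.
Qed.

Lemma mu_unit_itv : mu unit_itv = 1.
Proof. by rewrite /mu setIid lambda_unit_itv. Qed.

Lemma muU_le A B : measurable A -> measurable B -> mu (A `|` B) <= mu A + mu B.
Proof.
move=> mA mB; rewrite (@muID (A `|` B) A)//; last exact: measurableU.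
rewrite lerD//; apply: mu_le => //.
- by apply: measurableI => //; exact: measurableU.
- by apply: measurableD => //; exact: measurableU.
- by move=> x [[]].
Qed.

Lemma measurableY A B : measurable A -> measurable B -> measurable (A `+` B).
Proof. by move=> mA mB; apply: measurableU; exact: measurableD. Qed.

Lemma mu_dist A B : measurable A -> measurable B ->
  `|mu A - mu B| <= mu (A `+` B).
Proof.
move=> mA mB; have mY := measurableY mA mB; have mY' := measurableY mB mA.
have half C D : measurable C -> measurable D -> mu C <= mu D + mu (C `+` D).
  move=> mC mD; rewrite (@muID C D)// lerD//; apply: mu_le => //.
  - exact: measurableI.
  - exact: measurableD.
  - exact: measurableY.
  - by left.
have := half _ _ mA mB; have := half _ _ mB mA; rewrite setYC => *.
by rewrite ler_norml; apply/andP; split; lra.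
Qed.

Lemma mu_setY_tri B A C : measurable A -> measurable B -> measurable C ->
  mu (A `+` C) <= mu (A `+` B) + mu (B `+` C).
Proof.
move=> mA mB mC; apply: le_trans (muU_le _ _); try exact: measurableY.
apply: mu_le; first exact: measurableY.
  by apply: measurableU; exact: measurableY.
move=> x /= [[Ax nCx]|[Cx nAx]]; have [Bx|nBx] := pselect (B x); tauto.
Qed.

Lemma mu_bigsetU (I : Type) (s : seq I) (P : pred I) (F : I -> set R) :
  (forall i, measurable (F i)) ->
  mu (\big[setU/set0]_(i <- s | P i) F i) <= \sum_(i <- s | P i) mu (F i).
Proof.
move=> mF; elim: s => [|i s IH]; first by rewrite !big_nil /mu set0I measure0.
rewrite !big_cons; case: ifP => // _; apply: le_trans (muU_le _ _) _ => //.
  exact: bigsetU_measurable.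
by rewrite lerD2l.
Qed.

Lemma mu_setD A B : measurable A -> measurable B -> B `<=` A ->
  mu (A `\` B) = mu A - mu B.
Proof.
by move=> mA mB BA; rewrite (@muID A B)// (setIidr BA) addrC addKr.
Qed.

Lemma muC A : measurable A -> mu (~` A) = 1 - mu A.
Proof.
move=> mA; rewrite -mu_unit_itv (muID measurable_unit_itv mA) /mu.
by rewrite -setIA (setIC A) setIA setIid (setIC _ A) addrAC subrr add0r setDE
  (setIC _ (~` A)) -setIA setIid.
Qed.

Lemma mu_bigcup_cvg (E : nat -> set R) : (forall n, measurable (E n)) ->
  {homo E : m n / (m <= n)%N >-> m `<=` n} ->
  mu (E n) @[n --> \oo] --> mu (\bigcup_n E n).
Proof.
move=> mE ndE; rewrite /mu; apply: fine_cvg.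
have mB : measurable (\bigcup_n E n) by exact: bigcupT_measurable.
rewrite fineK; last by rewrite lambda_mu.
have mEI n : measurable (E n `&` unit_itv) by exact: measurableI.
rewrite setI_bigcupl; apply: nondecreasing_cvg_mu.
- exact: mEI.
- exact: (bigcupT_measurable _ mEI).
- move=> m n lemn; apply/subsetPset => x [Ex xI]; split => //.
  exact: (ndE m n).
Qed.

End mu.
#[global] Hint Resolve measurable_unit_itv : core.

(** * Predicates depending on finitely many bits *)

Definition finitary (p : bits -> bool) := exists n, determined n p.

Lemma finitary_and p q : finitary p -> finitary q -> finitary (fun b => p b && q b).
Proof.
move=> [m dp] [n dq]; exists (maxn m n) => b b' bb'.
by rewrite (dp _ b') 1?(dq _ b')//; apply: agree_le bb'; rewrite ?leq_maxl ?leq_maxr.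
Qed.

Lemma finitary_not p : finitary p -> finitary (fun b => ~~ p b).
Proof. by move=> [n dp]; exists n => b b' /dp ->. Qed.

Lemma finitary_bit i : finitary (fun b => b i).
Proof. by exists i.+1 => b b'; apply. Qed.

Lemma finitary_has (I : Type) (s : seq I) (p : I -> bits -> bool) :
  (forall i, finitary (p i)) -> finitary (fun b => has (p^~ b) s).
Proof.
move=> fp; elim: s => [|i s [n IH]]; first by exists 0%N.
have [m dp] := fp i; exists (maxn m n) => b b' bb' /=.
by rewrite (dp _ b') 1?(IH _ b')//; apply: agree_le bb'; rewrite ?leq_maxl ?leq_maxr.
Qed.

Lemma determined_restr n (P : {ffun 'I_n -> bool} -> bool) :
  determined n (fun b => P (restr n b)).
Proof. by move=> b b' /agree_restr ->. Qed.

Lemma finitary_restr n (P : {ffun 'I_n -> bool} -> bool) :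
  finitary (fun b => P (restr n b)).
Proof. by exists n; exact: determined_restr. Qed.

Lemma finitary_comp (F : bits -> bits) p : (forall i, finitary (F^~ i)) ->
  finitary p -> finitary (p \o F).
Proof.
move=> fF [n dp].
suff [m Hm] : exists m, forall b b', agree m b b' -> agree n (F b) (F b').
  by exists m => b b' /Hm /dp.
elim: n {dp} => [|n [m IH]]; first by exists 0%N.
have [k dF] := fF n; exists (maxn m k) => b b' bb' i.
rewrite ltnS leq_eqVlt => /orP[/eqP ->|].
  by apply: dF; apply: agree_le bb'; rewrite leq_maxr.
by apply: IH; apply: agree_le bb'; rewrite leq_maxl.
Qed.

Section prob.
Variable R : realType.
Local Notation event := (@event R).
Local Notation h := (2^-1 : R).

Lemma finitary_measurable p : finitary p -> measurable (event p).
Proof. by move=> [n]; exact: measurable_event. Qed.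

Lemma event_unit_itv p : event p `<=` unit_itv.
Proof. by move=> x [/andP[x0 x1] _]; rewrite /unit_itv/= in_itv/= x0 ltW. Qed.

Lemma eventI p q : event p `&` event q = event (fun b => p b && q b).
Proof.
apply/seteqP; split=> x; first by move=> [[x01 px] [_ qx]]; split=> //; rewrite px.
by move=> [x01 /andP[px qx]].
Qed.

Lemma eventD p q : event p `\` event q = event (fun b => p b && ~~ q b).
Proof.
apply/seteqP; split=> x.
  move=> [[x01 px] nqx]; split=> //; rewrite px/=.
  by apply/negP => qx; apply: nqx.
by move=> [x01 /andP[px /negP nqx]]; split => // -[_ /nqx].
Qed.

Lemma mu_event n p : determined n p ->
  mu (event p) = #|[pred v : {ffun 'I_n -> bool} | p (extend v)]|%:R * h ^+ n.
Proof.
move=> dp; rewrite /mu setIidl; last exact: event_unit_itv.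
by rewrite (lambda_event _ dp).
Qed.

Let hXK n : (2 ^ n)%:R * h ^+ n = 1 :> R.
Proof. by rewrite natrX -exprMn divff// expr1n. Qed.

Lemma mu_event_coord (iota : nat -> nat) p : injective iota -> finitary p ->
  mu (event (fun b => p (b \o iota))) = mu (event p).
Proof.
move=> iota_inj [n dp].
pose M := (\max_(i < n) iota i).+1.
have iotaM i : (i < n)%N -> (iota i < M)%N.
  by move=> ltin; rewrite ltnS (leq_bigmax (Ordinal ltin)).
have dM : determined M (fun b => p (b \o iota)).
  by move=> b b' bb'; apply: dp => i /iotaM; exact: bb'.
rewrite (mu_event dM) (mu_event dp).
have := card_determined_coord iota_inj iotaM dp.
move=> /(congr1 (fun k => k%:R : R)); rewrite !natrM.
have key (a c x y u v : R) : u * x = 1 -> v * y = 1 -> a * u = c * v ->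
    a * y = c * x.
  move=> ux vy E; rewrite -[a]mulr1 -ux mulrA E.
  by transitivity (c * x * (v * y)); [ring|rewrite vy mulr1].
exact: key.
Qed.

Lemma mu_event_independent (J : pred nat) p q :
  (forall b b', (forall k, J k -> b k = b' k) -> p b = p b') ->
  (forall b b', (forall k, ~~ J k -> b k = b' k) -> q b = q b') ->
  finitary p -> finitary q ->
  mu (event (fun b => p b && q b)) = mu (event p) * mu (event q).
Proof.
move=> pJ qJ [m dp] [n dq]; pose M := maxn m n.
have {}dp : determined M p by apply: determined_le dp; exact: leq_maxl.
have {}dq : determined M q by apply: determined_le dq; exact: leq_maxr.
have dpq : determined M (fun b => p b && q b).
  by move=> b b' bb'; rewrite (dp _ _ bb') (dq _ _ bb').
rewrite (mu_event dp) (mu_event dq) (mu_event dpq).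
have := card_independent M pJ qJ.
set a := #|_|; set c := #|_|; set d := #|_| => E.
rewrite mulrACA -natrM -E natrM -mulrA; congr (_ * _).
by rewrite mulrA hXK mul1r.
Qed.

Lemma mu_event_agree n (b : bits) :
  mu (event (fun b' => restr n b' == restr n b)) = h ^+ n.
Proof.
rewrite (mu_event (determined_restr (fun v => v == restr n b))).
rewrite (_ : #|_| = 1%N) ?mul1r// -(card1 (restr n b)).
by apply: eq_card => v; rewrite !inE extendK.
Qed.

End prob.

(** * From maps of binary digits to transformations *)

Section dyadic_approximation.
Variable R : realType.
Implicit Types (A U : set R) (x : R).
Local Notation event := (@event R).
Local Notation digit := (@digit R).

Lemma unit_itvE x : unit_itv x <-> 0 <= x <= 1.
Proof. by rewrite /unit_itv/= in_itv. Qed.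

Lemma unit_itv_cases x : unit_itv x -> 0 <= x < 1 \/ x = 1.
Proof.
rewrite unit_itvE => /andP[x0]; rewrite le_eqVlt => /orP[/eqP ->|x1]; first by right.
by left; rewrite x0.
Qed.

(* [event (inner U n)] is the union of the dyadic intervals of rank [n] contained
   in [U]. *)
Definition inner U n (b : bits) :=
  `[< event (fun b' => restr n b' == restr n b) `<=` U >].

Lemma determined_inner U n : determined n (inner U n).
Proof. by move=> b b' /agree_restr bb'; rewrite /inner bb'. Qed.

Lemma inner_sub U n : event (inner U n) `<=` U.
Proof. by move=> x [x01 /asboolP]; apply; split. Qed.

Lemma inner_nondecreasing U :
  {homo (fun n => event (inner U n)) : m n / (m <= n)%N >-> m `<=` n}.
Proof.
move=> m n lemn x [x01 /asboolP xU]; split => //; apply/asboolP.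
apply: subset_trans xU => y [y01 /eqP/agree_restr/(agree_le lemn) yx].
by split => //; apply/eqP/agree_restr.
Qed.

Lemma bigcup_inner U : open U ->
  \bigcup_n event (inner U n) = U `&` [set` `[0, 1[ ].
Proof.
move=> oU; apply/seteqP; split => x /=.
  by move=> [n _ xU]; split; [exact: inner_sub xU|case: xU; rewrite in_itv].
rewrite in_itv/= => -[Ux x01].
have /nbhs_ballP[e /= e0 eU] : nbhs x U by rewrite nbhsE; exists U.
have [n hn] := hX_lt e0; exists n => //; split => //; apply/asboolP.
move=> y [y01 /eqP/agree_restr yx]; apply: eU; rewrite /ball/=.
by apply: lt_trans hn; apply: agree_digits_dist => //; exact: agree_sym.
Qed.

Lemma inner_cvg U : open U -> mu (event (inner U n)) @[n --> \oo] --> mu U.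
Proof.
move=> oU; have mU := open_measurable oU.
have mE n : measurable (event (inner U n)).
  exact: measurable_event (@determined_inner U n).
have mB : measurable (\bigcup_n event (inner U n)) by exact: bigcupT_measurable.
have UE : U `&` [set` `[0, 1[ ] = \bigcup_n event (inner U n).
  by rewrite bigcup_inner.
have -> : mu U = mu (\bigcup_n event (inner U n)).
  apply/eqP; rewrite eq_le; apply/andP; split; last first.
    by apply: mu_le => //; rewrite -UE; exact: subIsetl.
  rewrite -[leRHS]addr0 -(mu_set1 1); apply: le_trans (muU_le _ _) => //.
  apply: mu_leI => //; first exact: measurableU.
  move=> x [Ux xI]; have [x01|->] := unit_itv_cases xI; last by right.
  by left; rewrite -UE; split => //=; rewrite in_itv.
exact: mu_bigcup_cvg mE (@inner_nondecreasing U).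
Qed.

Lemma outer_approximation A e : measurable A -> 0 < e ->
  exists U, [/\ open U, measurable U, A `&` unit_itv `<=` U & mu U < mu A + e].
Proof.
move=> mA e0; have mAI : measurable (A `&` unit_itv) by exact: measurableI.
have [|U [oU AU UA]] := lebesgue_regularity_outer mAI _ e0.
  by change (lambda (A `&` unit_itv) < +oo)%E; rewrite lambda_mu// ltry.
have mU := open_measurable oU; exists U; split => //.
have mD := measurableD mU mAI; rewrite (muID mU mAI) ler_ltD//.
  by apply: mu_le => //; [exact: measurableI|move=> x [_ []]].
rewrite -lte_fin -lambda_mu//; apply: le_lt_trans UA.
apply: le_measure; rewrite ?inE; last exact: subIsetl.
- exact: (measurableI _ _ mD (@measurable_unit_itv R)).
- exact: mD.
Qed.

(** Enclose [A] in an open set of nearly the same measure and take the dyadic intervals contained in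
    it. One threshold [N] serves all finer ranks, which later allows a common rank for several
    sets. *)
Lemma dyadic_approximation A e : measurable A -> 0 < e ->
  exists N, forall n, (N <= n)%N ->
    exists P : {ffun 'I_n -> bool} -> bool,
      mu (A `+` event (fun b => P (restr n b))) < e.
Proof.
move=> mA e0; have e20 : 0 < e / 2 by rewrite divr_gt0.
have [U [oU mU AU muUA]] := outer_approximation mA e20.
have /cvgrPdist_lt/(_ _ e20) [N _ HN] := inner_cvg oU.
exists N => n lenn; have := HN n lenn => /= {}HN.
exists (fun v => inner U n (extend v)).
have -> : event (fun b => inner U n (extend (restr n b))) = event (inner U n).
  apply/seteqP; split => x [x01 +]; split => //.
    by rewrite -(@determined_inner U n _ _ (@agree_extend n _)).
  by rewrite (@determined_inner U n _ _ (@agree_extend n _)).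
set E := event (inner U n); have EU : E `<=` U by exact: inner_sub.
have mE : measurable E by exact: measurable_event (@determined_inner U n).
have mAI : measurable (A `&` unit_itv) by exact: measurableI.
apply: (@le_lt_trans _ _ (mu ((U `\` (A `&` unit_itv)) `|` (U `\` E)))).
  apply: mu_leI; first exact: measurableY.
    by apply: measurableU; exact: measurableD.
  move=> x [[[Ax nEx]|[Ex nAx]] xI].
    by right; split => //; apply: AU.
  by left; split; [exact: EU|move=> -[]].
apply: le_lt_trans (muU_le _ _) _; try exact: measurableD.
rewrite [e in _ < e](splitr e) ltrD//; last first.
  by rewrite mu_setD//; apply: le_lt_trans HN; exact: ler_norm.
have := muID mU mAI; have -> : mu (U `&` (A `&` unit_itv)) = mu A.
  by rewrite (setIidr AU) /mu -setIA setIid.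
by move=> ?; lra.
Qed.

End dyadic_approximation.

(** * Lifting bijections of digit sequences to the unit interval *)

Section lift.
Variable R : realType.
Implicit Types (A U : set R) (x : R).
Local Notation event := (@event R).
Local Notation digit := (@digit R).

(* [many_zeros] has to be preserved because the sequences that end in ones are
   not sequences of greedy binary digits. *)
Record digit_map (F : bits -> bits) : Prop := DigitMap {
  digit_map_zeros : forall b, many_zeros b -> many_zeros (F b) ;
  digit_map_finitary : forall i, finitary (F^~ i) ;
  digit_map_mu : forall p, finitary p -> mu (event (p \o F)) = mu (event p) }.

Lemma digit_map_comp F G : digit_map F -> digit_map G -> digit_map (F \o G).
Proof.
move=> dF dG; split.
- by move=> b /(digit_map_zeros dG)/(digit_map_zeros dF).
- move=> i; apply: (finitary_comp (p := F^~ i)); first exact: digit_map_finitary.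
  exact: digit_map_finitary.
- move=> p fp; rewrite -(digit_map_mu dF fp).
  exact: (digit_map_mu dG (finitary_comp (digit_map_finitary dF) fp)).
Qed.

Variables F G : bits -> bits.
Hypotheses (dF : digit_map F) (dG : digit_map G).
Hypotheses (FK : cancel F G) (GK : cancel G F).

(** Fixing the point 1 keeps the lift of a bijection bijective on the closed interval. *)
Definition lift (F : bits -> bits) x : R :=
  if 0 <= x < 1 then bval R (F (digit x)) else x.

Lemma lift01 H x : digit_map H -> 0 <= x < 1 -> 0 <= lift H x < 1.
Proof.
move=> dH x01; rewrite /lift x01; apply: bval01.
by apply: (digit_map_zeros dH); exact: many_zeros_digit.
Qed.

Lemma digit_lift H x : digit_map H -> 0 <= x < 1 -> digit (lift H x) = H (digit x).
Proof.
move=> dH x01; rewrite /lift x01; apply: bvalK.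
by apply: (digit_map_zeros dH); exact: many_zeros_digit.
Qed.

Lemma lift1 H : lift H 1 = 1.
Proof. by rewrite /lift ltxx andbF. Qed.

Lemma lift_unit_itv H : digit_map H -> set_fun unit_itv unit_itv (lift H).
Proof.
move=> dH x xI; apply/unit_itvE.
have [/(lift01 dH)/andP[-> /ltW ->]//|->] := unit_itv_cases xI.
by rewrite lift1 ler01 lexx.
Qed.

Lemma liftK H K : digit_map H -> digit_map K -> cancel H K ->
  {in unit_itv, cancel (lift H) (lift K)}.
Proof.
move=> dH dK HK x /set_mem xI.
have [x01|->] := unit_itv_cases xI; last by rewrite !lift1.
have Hx01 := lift01 dH x01; apply: (@digit_inj R) => //; first exact: lift01.
by rewrite !digit_lift// HK.
Qed.

Lemma preimage_lift_event H p : digit_map H ->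
  unit_itv `&` lift H @^-1` event p = event (p \o H).
Proof.
move=> dH; apply/seteqP; split => x /=.
  move=> [xI [+ +]]; have [x01|->] := unit_itv_cases xI.
    by move=> _; rewrite digit_lift.
  by rewrite lift1 ltxx andbF.
move=> [x01 px]; split; first exact: (@event_unit_itv R xpredT).
by split; [exact: lift01|rewrite digit_lift].
Qed.

(** Up to the point 1, the preimage of an open set becomes a countable union of finitary events.
    Measurability and invariance of the measure are both derived from this form. *)
Lemma preimage_lift_open H U : digit_map H -> open U ->
  unit_itv `&` lift H @^-1` U =
  \bigcup_n event (inner U n \o H) `|` (U `&` [set 1]).
Proof.
move=> dH oU; apply/seteqP; split => x.
  move=> [xI /= Ux]; have [x01|x1] := unit_itv_cases xI; last first.
    by right; split => //; rewrite x1 lift1 in Ux; rewrite x1.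
  left; have : (\bigcup_n event (inner U n)) (lift H x).
    by rewrite bigcup_inner//; split => //=; rewrite in_itv/=; exact: lift01.
  by move=> [n _ Un]; exists n => //; rewrite -preimage_lift_event.
move=> [[n _]|[Ux x1]]; last first.
  rewrite {}x1 in Ux *.
  by split; [apply/unit_itvE; rewrite lexx ler01|rewrite /preimage/= lift1].
by rewrite -preimage_lift_event// => -[xI /inner_sub].
Qed.

Lemma finitary_inner U n : finitary (inner U n : bits -> bool).
Proof. by exists n; exact: determined_inner. Qed.

Lemma finitary_digit_map H p : digit_map H -> finitary p -> finitary (p \o H).
Proof. by move=> dH; apply: finitary_comp => i; exact: digit_map_finitary. Qed.

Lemma measurable_lift H : digit_map H -> measurable_fun unit_itv (lift H).
Proof.
move=> dH mI; apply: (measurability _ (RGenOInfty.measurableE R)) => //.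
move=> /= _ [_ [x ->] <-]; rewrite preimage_lift_open//.
apply: measurableU.
  apply: bigcupT_measurable => n; apply: finitary_measurable.
  by apply: finitary_digit_map => //; exact: finitary_inner.
by apply: measurableI => //; exact: measurable_itv.
Qed.

Lemma mu_preimage_lift A : measurable A ->
  mu (unit_itv `&` lift F @^-1` A) = mu A.
Proof.
have mpre B : measurable B -> measurable (unit_itv `&` lift F @^-1` B).
  by move=> mB; exact: (measurable_lift dF (@measurable_unit_itv R) mB).
(* Only [<=] is proved, through open sets from outside; equality follows by applying it to the
   complement as well. *)
have le B : measurable B -> mu (unit_itv `&` lift F @^-1` B) <= mu B.
  move=> mB; apply/ler_addgt0Pr => e e0.
  have [U [oU mU BU /ltW muUB]] := outer_approximation mB e0.
  apply: le_trans muUB; apply: (@le_trans _ _ (mu (unit_itv `&` lift F @^-1` U))).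
    apply: mu_le; [exact: mpre|exact: mpre|].
    by move=> x [xI Bx]; split => //; apply: BU; split => //; exact: lift_unit_itv.
  have mE n : measurable (event (inner U n \o F)).
    exact: finitary_measurable (finitary_digit_map dF (@finitary_inner U n)).
  apply: (@le_trans _ _ (mu (\bigcup_n event (inner U n \o F)))).
    rewrite preimage_lift_open// -[leRHS]addr0 -(mu_set1 1).
    have mUE : measurable (\bigcup_n event (inner U n \o F)).
      exact: bigcupT_measurable.
    apply: le_trans (muU_le _ _) _ => //; first exact: measurableI.
    by rewrite lerD2l; apply: mu_le => //; exact: measurableI.
  have cvgE : mu (event (inner U n \o F)) @[n --> \oo] -->
      mu (\bigcup_n event (inner U n \o F)).
    apply: mu_bigcup_cvg => // m n lemn; rewrite -!preimage_lift_event//.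
    by move=> x [xI Ux]; split => //; apply: inner_nondecreasing Ux.
  rewrite -(cvg_lim _ cvgE)//; apply: limr_le.
    by apply/cvg_ex; exists (mu (\bigcup_n event (inner U n \o F))).
  apply: nearW => n; rewrite (digit_map_mu dF); last exact: finitary_inner.
  apply: mu_le => //; last exact: inner_sub.
  exact: finitary_measurable (@finitary_inner U n).
move=> mA; apply/eqP; rewrite eq_le le//=.
have mCA : measurable (~` A) by exact: measurableC.
have := le _ mCA; rewrite muC//.
rewrite [mu (_ `&` _)](_ : _ = mu (~` (unit_itv `&` lift F @^-1` A))).
  by rewrite muC//; [lra|exact: mpre].
by rewrite /mu; congr (fine (lambda _)); apply/seteqP; split => x /=; tauto.
Qed.

Lemma lift_bimeasurable : bimeasurable (lift F).
Proof.
split; [exact: lift_unit_itv|exact: measurable_lift|exists (lift G); split].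
- exact: lift_unit_itv.
- exact: measurable_lift.
- exact: liftK.
- exact: liftK.
Qed.

Lemma lift_preserves : preserves_lambda (lift F).
Proof.
move=> A mA AI.
have mfA := measurable_lift dF (@measurable_unit_itv R) mA.
rewrite (lambda_muS mA AI) -(mu_preimage_lift mA); apply: lambda_muS => //.
Qed.

Definition lift_transformation := Transformation lift_bimeasurable lift_preserves.

End lift.

(** * A bijective coding of a Markov chain *)

Lemma coordinate_digit_map (R : realType) (s t : nat -> nat) :
  cancel s t -> cancel t s -> digit_map R (fun b => b \o s).
Proof.
move=> sK tK; split.
(* A zero of [b] beyond the images under [s] of all positions below [n] is carried to a position at
   least [n]. *)
- move=> b b0 n; have [j lej bj] := b0 (\max_(i < n) s i).+1.
  exists (t j); last by rewrite /= tK.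
  rewrite leqNgt; apply/negP => ltn; move: lej; apply/negP; rewrite -leqNgt.
  by rewrite -{1}(tK j) (leq_bigmax (Ordinal ltn)).
- by move=> i; exact: finitary_bit.
- by move=> p fp; apply: mu_event_coord => //; exact: can_inj sK.
Qed.

(** For every [n] at least [M], [Q] induces a permutation of the vectors of length [n], which
    preserves counts; bits from [M] on are untouched, so zeros keep occurring. *)
Lemma local_digit_map (R : realType) M (Q Q' : bits -> bits) : cancel Q Q' ->
  (forall n b b', (M <= n)%N -> agree n b b' -> agree n (Q b) (Q b')) ->
  (forall n b b', (M <= n)%N -> agree n b b' -> agree n (Q' b) (Q' b')) ->
  (forall b k, (M <= k)%N -> Q b k = b k) ->
  digit_map R Q.
Proof.
move=> QK Qloc Qloc' Qid; split.
- move=> b b0 n; have [k lek bk] := b0 (maxn n M).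
  by exists k; rewrite ?Qid//; apply: leq_trans lek; rewrite ?leq_maxl ?leq_maxr.
- move=> i; exists (maxn i.+1 M) => b b' /(Qloc _ _ _ (leq_maxr _ _)); apply.
  by rewrite leq_maxl.
move=> p [n0 dp]; pose n := maxn n0 M.
have {}dp : determined n p by apply: determined_le dp; exact: leq_maxl.
have leMn : (M <= n)%N by exact: leq_maxr.
have dpQ : determined n (p \o Q).
  by move=> b b' bb'; apply: dp; exact: Qloc.
rewrite (mu_event _ dp) (mu_event _ dpQ); congr (_%:R * _).
pose t (v : {ffun 'I_n -> bool}) := restr n (Q (extend v)).
have t_inj : injective t.
  move=> u v /agree_restr /(Qloc' _ _ _ leMn); rewrite !QK => /agree_restr.
  by rewrite !extendK.
rewrite -[RHS](card_reindex _ t_inj); apply: eq_card => v; rewrite !inE /=.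
by apply/esym/dp/agree_extend.
Qed.

Section positions.
Variable N : nat.

(* A bijection between two-sided and one-sided coordinates for which the
   coordinates [0 .. N-1] are the first [N] binary digits. *)
Definition pos (i : int) : nat :=
  match i with
  | Posz k => if (k < N)%N then k else (N + (k - N).*2)%N
  | Negz k => (N + k.*2.+1)%N
  end.

Definition unpos (k : nat) : int :=
  if (k < N)%N then Posz k
  else if odd (k - N) then Negz (k - N)./2 else Posz (N + (k - N)./2)%N.

Lemma posK : cancel pos unpos.
Proof.
case=> k; rewrite /pos /unpos.
  case: (ltnP k N) => [->//|leNk]; rewrite ltnNge leq_addr/= addKn odd_double.
  by rewrite doubleK subnKC.
by rewrite ltnNge leq_addr/= addKn /= odd_double /= uphalf_double.
Qed.

Lemma unposK : cancel unpos pos.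
Proof.
move=> k; rewrite /unpos; case: ltnP => [ltkN|leNk]; first by rewrite /= ltkN.
case: ifP => odd_k /=.
  by rewrite -[RHS](subnKC leNk) -[in RHS](odd_double_half (k - N)) odd_k.
rewrite ltnNge leq_addr/= addKn -[RHS](subnKC leNk).
by rewrite -[in RHS](odd_double_half (k - N)) odd_k.
Qed.

Lemma unpos_bound k r : (k < r)%N -> (- r%:Z <= unpos k) && (unpos k < r%:Z).
Proof.
move=> ltkr; rewrite /unpos; case: ltnP => ?; [|case: ifP => ?];
by apply/andP; split; lia.
Qed.

Lemma pos_bound (k : nat) : (pos k <= N + k.*2)%N.
Proof. by rewrite /pos; case: ltnP => ?; lia. Qed.

End positions.

Section model.
Variables (R : realType) (N m : nat).
Variables (P P' : {ffun 'I_N -> bool} -> {ffun 'I_N -> bool}).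
Hypotheses (PK : cancel P P') (PK' : cancel P' P).

Let L := (N + m)%N.

Local Notation pos := (pos N).
Local Notation unpos := (unpos N).
Implicit Types z : int -> bool.

(** Coordinates [0 .. L-1] hold the current block and [L .. 2L-1] the incoming one, each made of [N]
    state bits followed by [m] coin bits. The coin fires when the incoming coin bits all vanish. *)
Definition coin z := [forall i : 'I_m, ~~ z (Posz (L + N + i))].

(** Swapping instead of overwriting keeps the map invertible: the displaced fresh bits are put in
    the place of the old state, which the shift then moves into the past. *)
Definition refresh z (i : int) : bool :=
  if coin z then z i else
  match i with
  | Posz k => if (k < N)%N then z (Posz (L + k))
              else if (L <= k < L + N)%N
              then extend (P [ffun j : 'I_N => z (Posz j)]) (k - L) else z i
  | Negz _ => z i
  end.

Definition unrefresh z (i : int) : bool :=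
  if coin z then z i else
  match i with
  | Posz k => if (k < N)%N
              then extend (P' [ffun j : 'I_N => z (Posz (L + j))]) k
              else if (L <= k < L + N)%N then z (Posz (k - L)) else z i
  | Negz _ => z i
  end.

Lemma coin_local z z' : (forall k, (L <= k < L + L)%N -> z (Posz k) = z' (Posz k)) ->
  coin z = coin z'.
Proof.
by move=> zz'; apply: eq_forallb => i; rewrite zz'//; have := ltn_ord i; lia.
Qed.

Lemma refresh_local z z' i :
  (forall k, (k < L + L)%N -> z (Posz k) = z' (Posz k)) -> z i = z' i ->
  refresh z i = refresh z' i.
Proof.
move=> zz' zi; rewrite /refresh (@coin_local z z'); last first.
  by move=> k /andP[_]; exact: zz'.
case: ifP => // _; case: i zi => // k zk.
case: ifP => [?|_]; first by apply: zz'; lia.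
case: ifP => // _; congr (extend (P _) _); apply/ffunP => j; rewrite !ffunE.
by apply: zz'; have := ltn_ord j; lia.
Qed.

Lemma unrefresh_local z z' i :
  (forall k, (k < L + L)%N -> z (Posz k) = z' (Posz k)) -> z i = z' i ->
  unrefresh z i = unrefresh z' i.
Proof.
move=> zz' zi; rewrite /unrefresh (@coin_local z z'); last first.
  by move=> k /andP[_]; exact: zz'.
case: ifP => // _; case: i zi => // k zk; case: ifP => [?|_].
  congr (extend (P' _) _); apply/ffunP => j; rewrite !ffunE.
  by apply: zz'; have := ltn_ord j; lia.
by case: ifP => // ?; apply: zz'; lia.
Qed.

Lemma refresh_far z k : (L + N <= k)%N -> refresh z (Posz k) = z (Posz k).
Proof.
move=> lek; rewrite /refresh; case: ifP => // _.
by rewrite ifF ?ifF//; apply/negbTE; lia.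
Qed.

Lemma unrefresh_far z k : (L + N <= k)%N -> unrefresh z (Posz k) = z (Posz k).
Proof.
move=> lek; rewrite /unrefresh; case: ifP => // _.
by rewrite ifF ?ifF//; apply/negbTE; lia.
Qed.

Lemma coin_refresh z : coin (refresh z) = coin z.
Proof. by apply: eq_forallb => i; rewrite refresh_far//; lia. Qed.

Lemma coin_unrefresh z : coin (unrefresh z) = coin z.
Proof. by apply: eq_forallb => i; rewrite unrefresh_far//; lia. Qed.

Lemma refreshK z i : unrefresh (refresh z) i = z i.
Proof.
rewrite {1}/unrefresh coin_refresh; case: ifP => [c|c]; first by rewrite /refresh c.
case: i => k; last by rewrite /refresh c.
case: ifP => ltkN.
  rewrite [X in P' X](_ : _ = P [ffun j : 'I_N => z (Posz j)]).
    by rewrite PK (extend_ord _ (Ordinal ltkN)) ffunE.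
  apply/ffunP => j; rewrite !ffunE /refresh c ifF; last by apply/negbTE; lia.
  by rewrite ifT ?addKn ?extend_ord//; have := ltn_ord j; lia.
case: ifP => lek; rewrite /refresh c.
  by rewrite ifT ?subnKC//; lia.
by rewrite ltkN lek.
Qed.

Lemma unrefreshK z i : refresh (unrefresh z) i = z i.
Proof.
rewrite {1}/refresh coin_unrefresh; case: ifP => [c|c].
  by rewrite /unrefresh c.
case: i => k; last by rewrite /unrefresh c.
case: ifP => ltkN.
  rewrite /unrefresh c ifF; last by apply/negbTE; lia.
  by rewrite ifT ?addKn//; lia.
case: ifP => lek; last by rewrite /unrefresh c ltkN lek.
have ltkL : (k - L < N)%N by lia.
rewrite [X in P X](_ : _ = P' [ffun j : 'I_N => z (Posz (L + j))]).
  by rewrite PK' (extend_ord _ (Ordinal ltkL)) ffunE /= subnKC//; lia.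
apply/ffunP => j; rewrite !ffunE /unrefresh c ltn_ord.
by rewrite extend_ord.
Qed.

Definition refresh_digits (b : bits) : bits := refresh (b \o pos) \o unpos.
Definition unrefresh_digits (b : bits) : bits := unrefresh (b \o pos) \o unpos.

Lemma refresh_digitsK : cancel refresh_digits unrefresh_digits.
Proof.
move=> b; apply/funext => k; rewrite /unrefresh_digits /=.
rewrite (_ : refresh_digits b \o pos = refresh (b \o pos)).
  by rewrite refreshK /= unposK.
by apply/funext => i; rewrite /refresh_digits /= posK.
Qed.

Lemma unrefresh_digitsK : cancel unrefresh_digits refresh_digits.
Proof.
move=> b; apply/funext => k; rewrite /refresh_digits /=.
rewrite (_ : unrefresh_digits b \o pos = unrefresh (b \o pos)).
  by rewrite unrefreshK /= unposK.
by apply/funext => i; rewrite /unrefresh_digits /= posK.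
Qed.

(** Bounds the one-sided positions of the coordinates [0 .. 2L-1], outside which [refresh] copies
    its input. *)
Let M := (N + (L + L).*2)%N.

Lemma agree_pos n b b' : (M <= n)%N -> agree n b b' ->
  forall k, (k < L + L)%N -> (b \o pos) (Posz k) = (b' \o pos) (Posz k).
Proof.
move=> leMn bb' k ltk; apply: bb'.
by have := pos_bound N k; rewrite /M in leMn; lia.
Qed.

Lemma refresh_digits_local n b b' : (M <= n)%N -> agree n b b' ->
  agree n (refresh_digits b) (refresh_digits b').
Proof.
move=> leMn bb' k ltkn; apply: refresh_local; first exact: agree_pos bb'.
by rewrite /= unposK; exact: bb'.
Qed.

Lemma unrefresh_digits_local n b b' : (M <= n)%N -> agree n b b' ->
  agree n (unrefresh_digits b) (unrefresh_digits b').
Proof.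
move=> leMn bb' k ltkn; apply: unrefresh_local; first exact: agree_pos bb'.
by rewrite /= unposK; exact: bb'.
Qed.

Lemma unpos_far k : (M <= k)%N ->
  (exists j, unpos k = Negz j) \/ exists2 j, (L + N <= j)%N & unpos k = Posz j.
Proof.
rewrite /M /unpos => leMk; rewrite ifF; last by apply/negbTE; lia.
case: ifP => _; [left|right]; eexists; try reflexivity.
by lia.
Qed.

Lemma refresh_digits_far b k : (M <= k)%N -> refresh_digits b k = b k.
Proof.
move=> leMk; rewrite /refresh_digits /=.
have [[j E]|[j lej E]] := unpos_far leMk; rewrite E.
  by rewrite /refresh if_same -[in RHS](unposK N k) E.
by rewrite refresh_far// -[in RHS](unposK N k) E.
Qed.

Lemma unrefresh_digits_far b k : (M <= k)%N -> unrefresh_digits b k = b k.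
Proof.
move=> leMk; rewrite /unrefresh_digits /=.
have [[j E]|[j lej E]] := unpos_far leMk; rewrite E.
  by rewrite /unrefresh if_same -[in RHS](unposK N k) E.
by rewrite unrefresh_far// -[in RHS](unposK N k) E.
Qed.

Definition shift (d : int) (k : nat) : nat := pos (unpos k + d).

Lemma shiftK d : cancel (shift d) (shift (- d)).
Proof. by move=> k; rewrite /shift posK addrK unposK. Qed.

(** Refresh first, then shift by one block, so that the incoming block becomes the current one. *)
Definition model (b : bits) : bits := refresh_digits b \o shift L.
Definition model_inv (b : bits) : bits := unrefresh_digits (b \o shift (- L%:Z)).

Lemma modelK : cancel model model_inv.
Proof.
move=> b; rewrite /model_inv /model -[RHS]refresh_digitsK; congr unrefresh_digits.
by apply/funext => k /=; rewrite -{1}[L%:Z]opprK shiftK.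
Qed.

Lemma model_invK : cancel model_inv model.
Proof.
move=> b; rewrite /model_inv /model unrefresh_digitsK.
by apply/funext => k /=; rewrite shiftK.
Qed.

Lemma digit_map_shift d : digit_map R (fun b => b \o shift d).
Proof.
apply: (@coordinate_digit_map R _ (shift (- d))); first exact: shiftK.
by move=> k; rewrite -{1}[d]opprK shiftK.
Qed.

Lemma digit_map_model : digit_map R model.
Proof.
apply: (digit_map_comp (digit_map_shift L)).
exact: (local_digit_map R refresh_digitsK refresh_digits_local
  unrefresh_digits_local refresh_digits_far).
Qed.

Lemma digit_map_model_inv : digit_map R model_inv.
Proof.
apply: (@digit_map_comp R unrefresh_digits); last exact: digit_map_shift.
exact: (local_digit_map R unrefresh_digitsK unrefresh_digits_local
  refresh_digits_local unrefresh_digits_far).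
Qed.

Lemma model_pos b i : model b (pos i) = refresh (b \o pos) (i + L).
Proof. by rewrite /model /refresh_digits /= /shift !posK. Qed.

End model.

(** * Mixing of the coding *)

Section model_mixing.
Variables (R : realType) (N m : nat).
Variables (P P' : {ffun 'I_N -> bool} -> {ffun 'I_N -> bool}).
Hypotheses (PK : cancel P P') (PK' : cancel P' P).
Hypothesis m_gt0 : (0 < m)%N.

Let L := (N + m)%N.
Let pos := pos N.
Let unpos := unpos N.
Let F := model m P.
Local Notation event := (@event R).

Definition agree_from (i : int) (b b' : bits) :=
  forall j : int, i <= j -> b (pos j) = b' (pos j).

(** The coin of block [l]. A step of the model consults block 1, which block [l] reaches after
    [l - 1] steps when [l] is positive, by [coin_at_iter]. *)
Definition coin_at (l : nat) (b : bits) :=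
  [forall i : 'I_m, ~~ b (pos (Posz (l * L + N + i)))].

Lemma coin_at1 b : coin N m (b \o pos) = coin_at 1 b.
Proof. by rewrite /coin_at mul1n. Qed.

Lemma coin_at_agree i l b b' : agree_from i b b' -> i <= (l * L)%:Z ->
  coin_at l b = coin_at l b'.
Proof.
move=> bb' lei; apply: eq_forallb => j; rewrite bb'//.
by apply: le_trans lei _; lia.
Qed.

Lemma model_far b (j : nat) : (N <= j)%N -> F b (pos j) = b (pos (j + L)%N).
Proof. by move=> leNj; rewrite /F model_pos refresh_far//; lia. Qed.

Lemma coin_at_model l b : coin_at l (F b) = coin_at l.+1 b.
Proof.
apply: eq_forallb => j; rewrite model_far; last lia.
by rewrite mulSn; congr (~~ b (pos (Posz _))); lia.
Qed.

Lemma coin_at_iter t l b : coin_at l (iter t F b) = coin_at (l + t) b.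
Proof.
by elim: t l => [|t IH] l; rewrite ?addn0//= coin_at_model IH addSnnS.
Qed.

(** Refreshing leaves the coordinates from [L + N] on alone, so there the step is a plain shift. *)
Lemma agree_from_far (i : nat) b b' : (N <= i)%N ->
  agree_from (i + L)%N b b' -> agree_from i (F b) (F b').
Proof.
move=> leNi bb' [j|j] leij; last by move: leij; rewrite NegzE; lia.
by rewrite !model_far; [apply: bb'|lia|lia]; lia.
Qed.

(** When the coin fires nothing is exchanged: the new current block is the incoming one, whatever
    the old state was. *)
Lemma agree_from_coin b b' : agree_from L b b' -> coin_at 1 b ->
  agree_from 0 (F b) (F b').
Proof.
move=> bb' c j lej; have c' : coin_at 1 b'.
  by rewrite -(coin_at_agree bb')//; lia.
rewrite /F !model_pos /refresh !coin_at1 c c'; apply: bb'.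
by rewrite -/L; lia.
Qed.

(** Once the current and incoming blocks agree, the exchange is the same for both sequences, and the
    shift moves the agreement one block to the left. *)
Lemma agree_from_neg (k : nat) b b' : agree_from (- (k * L)%:Z) b b' ->
  agree_from (- (k.+1 * L)%:Z) (F b) (F b').
Proof.
move=> bb' j lej; rewrite /F !model_pos; apply: refresh_local => [i _|].
  by apply: bb'; lia.
by apply: bb'; rewrite -/L; lia.
Qed.

Lemma agree_from_le i j b b' : i <= j -> agree_from i b b' -> agree_from j b b'.
Proof. by move=> leij bb' k lejk; apply: bb'; exact: le_trans lejk. Qed.

(** The agreement moves left one block per step until it covers everything from block 1 on, and this
    much persists. Nothing is claimed about block 0, which may depend on the unknown state. *)
Lemma agree_from_iter_far (k t : nat) b b' : agree_from (k.+1 * L)%N b b' ->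
  (k <= t)%N -> agree_from L (iter t F b) (iter t F b').
Proof.
move=> bb' lekt.
have H s : (s <= k)%N -> agree_from ((k - s).+1 * L)%N (iter s F b) (iter s F b').
  elim: s => [|s IH] lesk; first by rewrite subn0.
  apply: agree_from_far.
    by rewrite mulSn; apply: leq_trans (leq_addr m N) (leq_addr _ _).
  have := IH (ltnW lesk).
  rewrite [((k - s).+1 * L)%N](_ : _ = ((k - s.+1).+1 * L + L)%N)//.
  by rewrite -mulSnr; congr (_.+1 * _)%N; lia.
rewrite -(subnK lekt); elim: (t - k)%N => [|s IH].
  by rewrite add0n; have := H _ (leqnn k); rewrite subnn mul1n.
apply: agree_from_far; first by rewrite /L; lia.
by apply: agree_from_le IH; lia.
Qed.

(* Once the coin has fired, the state is forgotten: everything the model shows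
   later is a function of coordinates to the right of the block [K]. *)
Lemma agree_from_iter (K l n : nat) b b' : (0 < K)%N -> (K <= l <= n)%N ->
  agree_from (K * L)%N b b' -> coin_at l b ->
  agree_from (- ((n - l) * L)%N%:Z) (iter n F b) (iter n F b').
Proof.
case: K => // K _ /andP[leKl leln] bb' cl.
case: l leKl leln cl => // l leKl leln cl.
have bl : agree_from 0 (iter l.+1 F b) (iter l.+1 F b').
  apply: agree_from_coin; first exact: agree_from_iter_far bb' _.
  by rewrite coin_at_iter add1n.
rewrite -{2 3}(subnK leln); elim: (n - l.+1)%N => [|s IH].
  by rewrite mul0n oppr0.
exact: agree_from_neg.
Qed.

Lemma finitary_coin_at l : finitary (coin_at l).
Proof.
exists (N + (l * L + N + m).*2)%N => b b' bb'; apply: eq_forallb => i.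
rewrite bb'//; apply: leq_ltn_trans (pos_bound N _) _.
by rewrite ltn_add2l ltn_double ltn_add2l ltn_ord.
Qed.

Lemma mu_coin_at l : mu (event (coin_at l)) = 2^-1 ^+ m.
Proof.
pose s (k : nat) := pos (Posz (l * L + N + k)).
have s_inj : injective s.
  by move=> j k /(can_inj (posK N)) [] /addnI.
rewrite -(mu_event_agree R m (fun=> false)).
rewrite -(mu_event_coord R s_inj (finitary_restr (fun v => v == restr m (fun=> false)))).
congr (mu (event _)); apply/funext => b; apply/forallP/eqP => [b0|/ffunP b0 i].
  by apply/ffunP => i; rewrite !ffunE; apply/negbTE/b0.
by have := b0 i; rewrite !ffunE => /= ->.
Qed.

Let coins K T b := has (coin_at^~ b) (iota K T).

Lemma finitary_coins K T : finitary (coins K T).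
Proof. by apply: finitary_has => l; exact: finitary_coin_at. Qed.

Lemma coins_agree K T b b' : agree_from (K * L)%N b b' ->
  coins K T b = coins K T b'.
Proof.
move=> bb'; apply: eq_in_has => l; rewrite mem_iota => /andP[leKl _].
by apply: coin_at_agree bb' _; rewrite lez_nat leq_mul2r leKl orbT.
Qed.

(** Coins of distinct blocks read disjoint coordinates, hence are independent; the induction splits
    off block [K] from those to its right. *)
Lemma mu_no_coins K T :
  mu (event (fun b => ~~ coins K T b)) = (1 - 2^-1 ^+ m) ^+ T.
Proof.
elim: T K => [|T IH] K.
  rewrite expr0 -[RHS](expr0 2^-1) -(mu_event_agree R 0 (fun=> false)).
  congr (mu (event _)); apply/funext => b; rewrite /coins/=; apply/esym/eqP.
  by apply/ffunP => -[].
have -> : (fun b => ~~ coins K T.+1 b) =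
    (fun b => ~~ coins K.+1 T b && ~~ coin_at K b).
  by apply/funext => b; rewrite /coins /= negb_or andbC.
rewrite (@mu_event_independent R (fun k => (K.+1 * L)%N%:Z <= unpos k)
  (fun b => ~~ coins K.+1 T b) (fun b => ~~ coin_at K b)).
- rewrite IH exprSr; congr (_ * _).
  have -> : event (fun b => ~~ coin_at K b) = event xpredT `\` event (coin_at K).
    by rewrite eventD; congr event.
  rewrite mu_setD//; first last.
  + by move=> x [x01 _].
  + exact: finitary_measurable (finitary_coin_at K).
  + by apply: finitary_measurable; exists 0%N.
  rewrite mu_coin_at; congr (_ - _).
  rewrite -[RHS](expr0 2^-1) -(mu_event_agree R 0 (fun=> false)).
  congr (mu (event _)); apply/funext => b; apply/esym/eqP.
  by apply/ffunP => -[].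
- move=> b b' bb'; congr (~~ _); apply: coins_agree => j lej.
  by apply: bb'; rewrite /unpos posK.
- move=> b b' bb'; congr (~~ _); apply: eq_forallb => i; congr (~~ _).
  apply: bb'; rewrite /unpos posK -ltNge ltz_nat.
  by have := ltn_ord i; rewrite mulSn /L; lia.
- by apply: finitary_not; exact: finitary_coins.
- by apply: finitary_not; exact: finitary_coin_at.
Qed.

Lemma mu_event_iter n p : finitary p ->
  finitary (p \o iter n F) /\ mu (event (p \o iter n F)) = mu (event p).
Proof.
have dF := digit_map_model R m PK.
elim: n p => [//|n IH] p fp.
have fpF : finitary (p \o F).
  by apply: finitary_comp => // i; exact: digit_map_finitary dF _.
have [f1 e1] := IH _ fpF; split => //.
by rewrite -(digit_map_mu dF fp) -e1.
Qed.

(** With [K = r.+1], [q] depends on coordinates to the left of block [K]. If a coin of the blocks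
    [K .. n-K-1] fires, [p] after [n] steps depends only on coordinates from block [K] on, whence
    independence. The bound is the probability that none of these [T] coins fires. *)
Lemma model_mixing_bound r n p q : determined r p -> determined r q ->
  (r.+1.*2 <= n)%N ->
  `|mu (event (fun b => p (iter n F b) && q b)) - mu (event p) * mu (event q)| <=
  (1 - 2^-1 ^+ m) ^+ (n - r.+1.*2).
Proof.
move=> dp dq len; set K := r.+1; set T := (n - K.*2)%N.
have fp : finitary p by exists r.
have fq : finitary q by exists r.
have [fpn mupn] := mu_event_iter n fp.
have L_gt0 : (0 < L)%N by rewrite /L; lia.
pose e := (1 - 2^-1 ^+ m) ^+ T : R.
have indep : mu (event (fun b => (coins K T b && p (iter n F b)) && q b)) =
    mu (event (fun b => coins K T b && p (iter n F b))) * mu (event q).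
  apply: (@mu_event_independent R (fun k => (K * L)%N%:Z <= unpos k)
    (fun b => coins K T b && p (iter n F b)) q) => //.
  - move=> b b' bb'.
    have {}bb' : agree_from (K * L)%N b b'.
      by move=> j lej; apply: bb'; rewrite /unpos posK.
    rewrite -(coins_agree T bb'); case: (boolP (coins K T b)) => //= /hasP[l].
    rewrite mem_iota => /andP[leKl ltl] cl.
    have leln : (K <= l <= n)%N by rewrite /T in ltl; lia.
    have bbn := agree_from_iter (ltn0Sn r) leln bb' cl.
    (* The digit [k] has two-sided coordinate at least [- r], and the agreement starts no later than
       that because [l < n - K]. *)
    apply: dp => k ltkr; rewrite -(unposK N k); apply: bbn.
    have /andP[+ _] := unpos_bound N ltkr; apply: le_trans.
    rewrite lerN2 lez_nat; apply: leq_trans (leq_pmulr _ L_gt0).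
    by rewrite /T in ltl; lia.
  - move=> b b' bb'; apply: dq => k ltkr; apply: bb'.
    rewrite -ltNge; have /andP[_ /lt_le_trans] := unpos_bound N ltkr; apply.
    by rewrite lez_nat; apply: leq_trans (leq_pmulr _ L_gt0).
  - by apply: finitary_and => //; exact: finitary_coins.
have part s : finitary s ->
    mu (event (fun b => coins K T b && s b)) <= mu (event s) <=
    mu (event (fun b => coins K T b && s b)) + e.
  move=> fs; have mc := @finitary_measurable R _ (finitary_coins K T).
  have ms := @finitary_measurable R _ fs.
  rewrite (muID ms mc) eventI eventD.
  rewrite (_ : (fun b => s b && coins K T b) =
      (fun b => coins K T b && s b)); last first.
    by apply/funext => b; rewrite andbC.
  rewrite lerDl mu_ge0 lerD2l /e -(mu_no_coins K T).
  apply: mu_le => [||x [x01 /andP[_ nc]]]; last by split.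
    apply: finitary_measurable; apply: finitary_and => //.
    by apply: finitary_not; exact: finitary_coins.
  by apply: finitary_measurable; apply: finitary_not; exact: finitary_coins.
have /andP[] := part _ (finitary_and fpn fq).
have /andP[] := part _ fpn; rewrite mupn.
rewrite (_ : (fun b => coins K T b && (_ && _)) =
    (fun b => (coins K T b && p (iter n F b)) && q b)); last first.
  by apply/funext => b; rewrite andbA.
rewrite indep; set y := mu (event (fun b => coins K T b && _)).
have : mu (event q) <= 1 by rewrite -(mu_unit_itv R); apply: mu_le => //;
  [exact: finitary_measurable|exact: event_unit_itv].
have := mu_ge0 (event q); set a := mu (event q); set c := mu (event p).
rewrite -/e => a0 a1 yc cy x1 x2; rewrite ler_norml.
(* Both the measure of the joint event and [c * a] lie between [y * a] and [y * a + e]. *)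
have /= h1 := ler_wpM2r a0 yc; have /= h2 := ler_wpM2r a0 cy.
have e0 : 0 <= e by apply: exprn_ge0; rewrite subr_ge0 exprn_ile1// invf_le1// ler1n.
have h3 : e * a <= e by rewrite ler_piMr.
rewrite mulrDl in h2; apply/andP; split; lra.
Qed.

End model_mixing.

(** * Images under transformations *)

Section images.
Variable R : realType.
Implicit Types (S T : transformation R) (A B : set R).

Lemma transformation_inj T : set_inj unit_itv T.
Proof.
have [_ _ [U [_ _ TK _]]] := transformation_bimeasurable T.
by move=> x y xI yI Txy; rewrite -(TK x)// Txy TK.
Qed.

Lemma image_sub_unit_itv T A : A `<=` unit_itv -> T @` A `<=` unit_itv.
Proof.
have [TI _ _] := transformation_bimeasurable T.
by move=> AI _ [x Ax <-]; apply/TI/AI.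
Qed.

Lemma measurable_image T A : measurable A -> A `<=` unit_itv -> measurable (T @` A).
Proof.
have [TI _ [U [UI mU TK UK]]] := transformation_bimeasurable T.
move=> mA AI; rewrite (_ : T @` A = unit_itv `&` U @^-1` A).
  exact: (mU (@measurable_unit_itv R) _ mA).
apply/seteqP; split => [_ [x Ax <-]|y [yI UyA]].
  by split; [exact/TI/AI|rewrite /preimage/= TK//; apply/mem_set/AI].
by exists (U y) => //; rewrite UK//; exact/mem_set.
Qed.

Lemma mu_image T A : measurable A -> A `<=` unit_itv -> mu (T @` A) = mu A.
Proof.
move=> mA AI; have mTA := measurable_image T mA AI.
have := @transformation_preserves R T _ mTA (image_sub_unit_itv AI).
rewrite (lambda_muS mTA); last exact: image_sub_unit_itv.
rewrite (_ : _ `&` _ = A) ?lambda_muS// => [[]//|].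
apply/seteqP; split => [x [xI [y Ay /transformation_inj <-//]]|x Ax].
- by rewrite inE; exact: AI.
- by rewrite inE.
- by split; [exact: AI|exists x].
Qed.

Lemma image_setY T A B : A `<=` unit_itv -> B `<=` unit_itv ->
  T @` (A `+` B) = (T @` A) `+` (T @` B).
Proof.
move=> AI BI; have inj x y : unit_itv x -> unit_itv y -> T x = T y -> x = y.
  by move=> xI yI; apply: (@transformation_inj T); rewrite inE.
apply/seteqP; split => [_ [x [[Ax nBx]|[Bx nAx]] <-]|_ [[[x Ax <-] nB]|[[x Bx <-] nA]]].
- left; split; [by exists x|move=> [y By /inj yx]].
  by apply: nBx; rewrite -yx//; [exact: BI|exact: AI].
- right; split; [by exists x|move=> [y Ay /inj yx]].
  by apply: nAx; rewrite -yx//; [exact: AI|exact: BI].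
- by exists x => //; left; split => // Bx; apply: nB; exists x.
- by exists x => //; right; split => // Ax; apply: nA; exists x.
Qed.

Lemma mu_image_setY T A B : measurable A -> measurable B ->
  A `<=` unit_itv -> B `<=` unit_itv ->
  mu ((T @` A) `+` (T @` B)) = mu (A `+` B).
Proof.
move=> mA mB AI BI; rewrite -image_setY// mu_image//; first exact: measurableY.
by move=> x [[/AI]|[/BI]].
Qed.

Lemma iter_bimeasurable T k : bimeasurable (iter k T).
Proof.
have [TI mT [U [UI mU TK UK]]] := transformation_bimeasurable T.
have iterI (V : R -> R) : set_fun unit_itv unit_itv V ->
    set_fun unit_itv unit_itv (iter k V).
  by move=> VI; elim: k => [//|n IH] x /IH /VI.
have miter (V : R -> R) n : set_fun unit_itv unit_itv V ->
    measurable_fun unit_itv V -> measurable_fun unit_itv (iter n V).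
  move=> VI mV; elim: n => [|n IH]; first exact: measurable_id.
  have VnI : set_fun unit_itv unit_itv (iter n V).
    by elim: n {IH} => [//|n IH] x /IH /VI.
  apply: (measurable_comp (@measurable_unit_itv R) _ mV IH).
  by move=> _ [x xI <-]; exact: VnI.
have iterK (V W : R -> R) n : set_fun unit_itv unit_itv V ->
    {in unit_itv, cancel V W} -> {in unit_itv, cancel (iter n V) (iter n W)}.
  move=> VI VK x; elim: n x => [//|n IH] x xI.
  rewrite [iter _ V _]iterSr iterS IH ?VK//.
  by apply/mem_set/VI/set_mem.
split; [exact: iterI|exact: miter|exists (iter k U); split].
- exact: iterI.
- exact: miter.
- exact: iterK.
- exact: iterK.
Qed.

Lemma iter_preserves T k : preserves_lambda (iter k T).
Proof.
have [TI mT _] := transformation_bimeasurable T.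
elim: k => [|k IH] A mA AI; first by rewrite setIidr.
rewrite -(IH A mA AI) -(@transformation_preserves _ T (unit_itv `&` iter k T @^-1` A)).
- congr (lambda _); apply/seteqP; split => x; rewrite /preimage/= -iterS iterSr.
    by move=> [xI ?]; split => //; split => //; exact: TI.
  by move=> [xI [_ ?]].
- have [_ mTk _] := iter_bimeasurable T k.
  exact: (mTk (@measurable_unit_itv R) _ mA).
- exact: subIsetl.
Qed.

Definition iter_transformation T k :=
  Transformation (iter_bimeasurable T k) (iter_preserves T k).

(** Apply the measure-preserving [T] to the set on the left. This passes from preimages, in which
    mixing is stated, to images, in which the weak topology is. *)
Lemma lambda_preimage_image T A B : measurable A -> measurable B ->
  A `<=` unit_itv -> B `<=` unit_itv ->
  lambda ((T @^-1` A) `&` B) = (mu (A `&` T @` B))%:E.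
Proof.
move=> mA mB AI BI; have [TI mT _] := transformation_bimeasurable T.
have E : (T @^-1` A) `&` B = (unit_itv `&` T @^-1` A) `&` B.
  by apply/seteqP; split => x /= [] => [Ax Bx|[_ ?] ?];
    split => //; split => //; exact: BI.
have mTA := mT (@measurable_unit_itv R) _ mA.
rewrite E lambda_muS; [|exact: measurableI|by move=> x [_ /BI]].
congr EFin; rewrite -(mu_image T); [|exact: measurableI|by move=> x [_ /BI]].
congr mu; apply/seteqP; split => [_ [x [[_ Ax] Bx] <-]|y [Ay [x Bx Ty]]].
  by split => //; exists x.
by exists x => //; split => //; split; [exact: BI|rewrite /preimage/= Ty].
Qed.

(** Both maps preserve the measure of symmetric differences, so replacing [A] by [B] is paid once
    for each map. *)
Lemma mu_image_setY_tri S T A B : measurable A -> measurable B ->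
  A `<=` unit_itv -> B `<=` unit_itv ->
  mu ((S @` A) `+` (T @` A)) <=
  mu ((S @` B) `+` (T @` B)) + 2 * mu (A `+` B).
Proof.
move=> mA mB AI BI; have mI (V : transformation R) (C : set R) :
    measurable C -> C `<=` unit_itv -> measurable (V @` C).
  exact: (@measurable_image V).
have := mu_setY_tri (mI S _ mA AI) (mI S _ mB BI) (mI T _ mA AI).
have := mu_setY_tri (mI S _ mB BI) (mI T _ mB BI) (mI T _ mA AI).
by rewrite !mu_image_setY// (setYC B A); lra.
Qed.

(** Telescoping: the step to [k.+1] passes through the [S]-image of the [k]-th [T]-iterate of [B],
    and [S] preserves the distance accumulated so far. Continuity of powers in the weak topology
    rests on this. *)
Lemma mu_iter_image_le S T B k : measurable B -> B `<=` unit_itv ->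
  mu ((iter k S @` B) `+` (iter k T @` B)) <=
  \sum_(l < k) mu ((S @` (iter l T @` B)) `+` (T @` (iter l T @` B))).
Proof.
move=> mB BI; elim: k => [|k IH].
  by rewrite big_ord0 /= setYK /mu set0I measure0.
have mk V := @measurable_image (iter_transformation V k) _ mB BI.
have Ik V := @image_sub_unit_itv (iter_transformation V k) _ BI.
rewrite big_ord_recr /=.
have E V : (fun x => V (iter k V x)) @` B = V @` (iter k V @` B).
  by rewrite image_comp.
rewrite !E; apply: le_trans (mu_setY_tri (B := S @` (iter k T @` B)) _ _ _) _.
- exact: measurable_image (mk S) (Ik S).
- exact: measurable_image (mk T) (Ik T).
- exact: measurable_image (mk T) (Ik T).
by rewrite lerD2r (mu_image_setY S (mk S) (mk T) (Ik S) (Ik T)).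
Qed.

(** A point of one image missing from the other comes from a point where the maps differ, so the
    symmetric difference lies in the two images of a null set. *)
Lemma ae_eq_image S T A : ae_eq lambda unit_itv S T -> measurable A ->
  A `<=` unit_itv -> mu ((S @` A) `+` (T @` A)) = 0.
Proof.
move=> [N [mN' N0 SN]] mA AI; have mN : measurable (N : set R) := mN'.
 apply/eqP; rewrite eq_le mu_ge0 andbT.
pose M : set R := N `&` unit_itv; have mM : measurable M by exact: measurableI.
have MI : M `<=` unit_itv by exact: subIsetr.
have muM : mu M = 0.
  apply/eqP; rewrite eq_le mu_ge0 andbT -lee_fin -(lambda_muS mM MI).
  apply: (@le_trans _ _ (lambda N)); last by rewrite N0.
  by apply: le_measure; rewrite ?inE//; exact: subIsetl.
apply: (@le_trans _ _ (mu (S @` M `|` T @` M))).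
  apply: mu_le.
  - by apply: measurableY; exact: measurable_image.
  - by apply: measurableU; exact: measurable_image.
  have same x : A x -> S x <> T x -> M x.
    by move=> Ax ST; split; [apply: SN => /(_ (AI _ Ax))|exact: AI].
  move=> _ [[[x Ax <-] nT]|[[x Ax <-] nS]].
    by left; exists x => //; apply: same => // ST; apply: nT; exists x.
  by right; exists x => //; apply: same => // ST; apply: nS; exists x.
apply: le_trans (muU_le _ _) _; try exact: measurable_image.
by rewrite !mu_image// muM addr0.
Qed.

End images.

(** * The mixing transformation carried by the coding *)

Section model_transformation.
Variables (R : realType) (N m : nat).
Variables (P P' : {ffun 'I_N -> bool} -> {ffun 'I_N -> bool}).
Hypotheses (PK : cancel P P') (PK' : cancel P' P).
Local Notation event := (@event R).
Local Notation digit := (@digit R).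

Definition model_transformation : transformation R :=
  lift_transformation (digit_map_model R m PK) (digit_map_model_inv R m PK')
    (modelK m PK) (model_invK m PK').

Let S := model_transformation.

Lemma iter_model_transformation n x : 0 <= x < 1 ->
  0 <= iter n S x < 1 /\ digit (iter n S x) = iter n (model m P) (digit x).
Proof.
have dF := digit_map_model R m PK.
move=> x01; elim: n => [//|n [IH dIH]]; split; first exact: lift01 dF IH.
by rewrite !iterS -dIH; exact: digit_lift dF IH.
Qed.

Lemma preimage_model_transformation n p q :
  (iter n S @^-1` event p) `&` event q =
  event (fun b => p (iter n (model m P) b) && q b).
Proof.
apply/seteqP; split => x.
  move=> [[_ px] [x01 qx]]; have [xn01 dx] := iter_model_transformation n x01.
  by split => //; rewrite -dx px.
move=> [x01 /andP[px qx]]; have [xn01 dx] := iter_model_transformation n x01.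
by split; split => //; rewrite dx.
Qed.

Lemma model_transformation_mixing r p q e : (0 < m)%N -> determined r p ->
  determined r q -> 0 < e ->
  exists n0, forall n, (n0 <= n)%N ->
   `|mu ((iter n S @^-1` event p) `&` event q) - mu (event p) * mu (event q)| < e.
Proof.
move=> m_gt0 dp dq e0; pose a : R := 1 - 2^-1 ^+ m.
have a0 : 0 <= a by rewrite subr_ge0 exprn_ile1// invf_le1// ler1n.
have a1 : a < 1 by rewrite ltrBlDr ltrDl hX_gt0.
have : (a ^+ n @[n --> \oo] --> (0 : R)) by apply: cvg_expr; rewrite ger0_norm.
move=> /cvgr0_norm_lt /(_ _ e0) [n1 _ Hn1]; exists (n1 + r.+1.*2)%N => n len.
rewrite preimage_model_transformation.
apply: le_lt_trans (model_mixing_bound R PK m_gt0 dp dq _) _; first by lia.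
have /= := Hn1 (n - r.+1.*2)%N; rewrite ger0_norm ?exprn_ge0//; apply.
by lia.
Qed.

Lemma restr_model b : ~~ coin_at N m 1 b -> restr N (model m P b) = P (restr N b).
Proof.
rewrite -coin_at1 => nc; apply/ffunP => k; rewrite ffunE.
have {1}-> : nat_of_ord k = pos N (Posz k) by rewrite /pos ltn_ord.
have ltkN := ltn_ord k.
rewrite model_pos /refresh (negbTE nc) /= ifF; last by apply/negbTE; lia.
rewrite ifT; last by lia.
rewrite addnK extend_ord; congr (P _ _); apply/ffunP => j.
by rewrite !ffunE /= ltn_ord.
Qed.

(** Where the coin of block 1 does not fire, one step acts on the first [N] digits as [P]. So the
    symmetric difference lies in the image of the event where it fires. *)
Lemma model_transformation_close (D : {ffun 'I_N -> bool} -> bool) :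
  mu ((S @` event (fun b => D (restr N b))) `+`
      event (fun b => D (P' (restr N b)))) <= 2^-1 ^+ m.
Proof.
have dF := digit_map_model R m PK; have dG := digit_map_model_inv R m PK'.
rewrite -(mu_coin_at R N m 1).
have mC : measurable (event (coin_at N m 1)).
  exact: finitary_measurable (finitary_coin_at N m 1).
have mD E : measurable (event (fun b => E (restr N b))).
  exact: finitary_measurable (finitary_restr E).
rewrite -(mu_image S mC); last exact: event_unit_itv.
apply: mu_le.
- apply: measurableY; last exact: (mD (D \o P')).
  by apply: measurable_image => //; exact: event_unit_itv.
- by apply: measurable_image => //; exact: event_unit_itv.
have next x : 0 <= x < 1 -> ~~ coin_at N m 1 (digit x) ->
    P' (restr N (digit (S x))) = restr N (digit x).
  by move=> x01 nc; rewrite [digit _](digit_lift dF x01) restr_model// PK.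
move=> y [[[x [x01 Dx] <-] nD]|[[y01 Dy] nS]].
  exists x => //; split => //; apply: contrapT => /negP nc; apply: nD; split.
    exact: lift01 dF x01.
  by rewrite next.
pose x : R := lift (model_inv m P') y; have x01 : 0 <= x < 1 := lift01 dG y01.
have Sx : S x = y.
  by apply: (liftK dG dF (model_invK m PK')); apply/mem_set/(@event_unit_itv R xpredT).
exists x => //; split => //; apply: contrapT => /negP nc; apply: nS; exists x => //.
by split => //; rewrite -next// Sx.
Qed.

End model_transformation.

(** * Approximation by dyadic permutations *)

(* Take [P] maximising the number of points sent into the good set of their
   label: if some label had both a misplaced point and an unfilled good place,
   a transposition would improve [P]. *)
Lemma perm_fill (V W : finType) (label : V -> W) (good : W -> pred V) :
  (forall i j v, good i v -> good j v -> i = j) ->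
  exists P : {perm V}, forall j,
    (forall v, label v = j -> good j (P v)) \/
    (forall v, good j (P v) -> label v = j).
Proof.
move=> good_inj; pose score (P : {perm V}) := #|[pred v | good (label v) (P v)]|.
have [P _ Pmax] := arg_maxnP (P := xpredT) score (i0 := perm (@inj_id V)) isT.
exists P => j.
have [fill|/existsNP[i /not_implyP[li /negP ni]]] :=
  pselect (forall v, label v = j -> good j (P v)); first by left.
right=> v gv; apply: contrapT => lv.
have nv : ~~ good (label v) (P v).
  by apply/negP => gv'; apply: lv; exact: good_inj gv' gv.
pose Q := (tperm i v * P)%g; have QE w : Q w = P (tperm i v w) by rewrite permM.
suff lt : (score P < score Q)%N by have /= := Pmax Q isT; rewrite leqNgt lt.
apply: proper_card; apply/properP; split; last first.
  by exists i; rewrite inE ?li// QE tpermL.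
apply/fintype.subsetP => w; rewrite !inE QE => gw; rewrite tpermD//.
  by apply: contraNneq ni => wi; rewrite -li wi.
by apply: contraNneq nv => ->.
Qed.

Section halmos.
Variables (R : realType) (T : transformation R).
Local Notation event := (@event R).
Local Notation digit := (@digit R).

Lemma sub_bigsetU (I : finType) (F : I -> set R) i : F i `<=` \big[setU/set0]_j F j.
Proof. by move=> x Fx; rewrite (bigD1 i)//=; left. Qed.

Let cyl N (u : {ffun 'I_N -> bool}) := event (fun b => restr N b == u).

Let measurable_restr N (D : {ffun 'I_N -> bool} -> bool) :
  measurable (event (fun b => D (restr N b))).
Proof. exact: finitary_measurable (finitary_restr D). Qed.

Let measurable_T N (D : {ffun 'I_N -> bool} -> bool) :
  measurable (T @` event (fun b => D (restr N b))).
Proof. by apply: measurable_image => //; exact: event_unit_itv. Qed.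

Lemma mu_event_card N (D : {ffun 'I_N -> bool} -> bool) :
  mu (event (fun b => D (restr N b))) = #|[pred v | D v]|%:R * 2^-1 ^+ N.
Proof.
rewrite (mu_event R (determined_restr D)); congr (_%:R * _).
by apply: eq_card => v; rewrite !inE extendK.
Qed.

Lemma restr_restr N M b : (N <= M)%N -> restr N (extend (restr M b)) = restr N b.
Proof. by move=> leNM; apply/agree_restr/(agree_le leNM)/agree_extend. Qed.

Lemma dyadic_images N e : 0 < e -> exists M0, forall M, (M0 <= M)%N ->
  exists F : {ffun 'I_N -> bool} -> {ffun 'I_M -> bool} -> bool,
    forall u, mu ((T @` cyl u) `+` event (fun b => F u (restr M b))) < e.
Proof.
move=> e0; have H (u : {ffun 'I_N -> bool}) :=
  dyadic_approximation (measurable_T (pred1 u)) e0.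
have [M0 M0P] := choice H; exists (\max_u M0 u)%N => M leM.
have H' u := M0P u M (leq_trans (leq_bigmax u) leM).
by have [F FP] := choice H'; exists F.
Qed.

(** The images of the cylinders of rank [N] are disjoint and of equal measure, so up to a small
    error they are filled by equally many dyadic intervals of a fine rank [M]; the permutation sends
    the intervals inside a cylinder to those filling its image. *)
Lemma dyadic_permutation_cylinders N e : 0 < e -> exists M, (N <= M)%N /\
  exists P : {perm {ffun 'I_M -> bool}}, forall u : {ffun 'I_N -> bool},
    mu ((T @` cyl u) `+`
      event (fun b => restr N (extend ((P^-1)%g (restr M b))) == u)) < e.
Proof.
(* Chosen so that the [2 ^ N] errors add up to [e / 2]. *)
move=> e0; pose d : R := e / (2 * (2 ^ N)%:R).
have d0 : 0 < d by rewrite divr_gt0// mulr_gt0// ltr0n expn_gt0.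
have [M0 M0P] := dyadic_images N d0.
pose M := maxn N M0; have [F FP] := M0P M (leq_maxr _ _).
have leNM : (N <= M)%N by exact: leq_maxl.
exists M; split => //.
pose label (v : {ffun 'I_M -> bool}) := restr N (extend v).
(* The points claimed by [F u] alone, so that the good sets are disjoint as [perm_fill] requires. *)
pose good u v := F u v && [forall (u' | u' != u), ~~ F u' v].
have good_inj i j v : good i v -> good j v -> i = j.
  move=> /andP[Fi _] /andP[_ /forallP/(_ i)]; rewrite Fi /= implybF negbK.
  by move/eqP.
have [P Pfill] := perm_fill label good_inj; exists P => u.
pose E (w : {ffun 'I_N -> bool}) := T @` cyl w.
pose Fe w := event (fun b => F w (restr M b)).
pose G := event (fun b => good u (restr M b)).
pose PD := event (fun b => label ((P^-1)%g (restr M b)) == u).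
have mE w : measurable (E w) by exact: (measurable_T (pred1 w)).
have mF w : measurable (Fe w) by exact: (measurable_restr (F w)).
have mG : measurable G by exact: (measurable_restr (good u)).
have mPD : measurable PD.
  exact: (measurable_restr (fun v => label ((P^-1)%g v) == u)).
have E_inj w w' x : E w x -> E w' x -> w = w'.
  move=> [y [y01 /eqP <-] <-] [y' [y'01 /eqP <-]] yy'.
  by rewrite (@transformation_inj R T y' y)//; apply/mem_set/(@event_unit_itv R xpredT).
have EG : mu (E u `+` G) < e / 2.
  apply: (@le_lt_trans _ _ (mu (\big[setU/set0]_w (E w `+` Fe w)))).
    apply: mu_le; first exact: measurableY.
      by apply: bigsetU_measurable => w _; exact: measurableY.
    move=> x [[Ex nG]|[[x01 /andP[Fx _]] nE]]; last first.
      by apply: (@sub_bigsetU _ _ u); right.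
    have [[x01 Fx]|nF] := pselect (Fe u x); last first.
      by apply: (@sub_bigsetU _ _ u); left.
    (* The point lies in [E u] and [Fe u] but is not good, so some other [w] claims it; the images
       being disjoint, it is in [Fe w] and not in [E w]. *)
    have [w wu Fw] : exists2 w, w != u & F w (restr M (digit x)).
      apply: contrapT => no; apply: nG; split => //; rewrite /good Fx /=.
      by apply/forall_inP => w wu; apply/negP => Fw; apply: no; exists w.
    apply: (@sub_bigsetU _ _ w); right; split=> // Ew.
    by move: wu; rewrite (E_inj _ _ _ Ew Ex) eqxx.
  apply: le_lt_trans (mu_bigsetU _ _ _) _; first by move=> w; exact: measurableY.
  have -> : e / 2 = \sum_(w : {ffun 'I_N -> bool}) d.
    rewrite sumr_const card_bits -(mulr_natr d) /d.
    by rewrite invfM mulrA mulfVK// pnatr_eq0 expn_eq0.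
  apply: ltr_sum => [|w _]; last exact: FP.
  by apply/hasP; exists u; rewrite ?mem_index_enum.
have PDE : mu PD = mu (E u).
  rewrite mu_image//; [|exact: (measurable_restr (pred1 u))|exact: event_unit_itv].
  rewrite (mu_event_card (fun v => label ((P^-1)%g v) == u)).
  rewrite (card_reindex (fun v => label v == u) (@perm_inj _ (P^-1)%g)).
  rewrite -(mu_event_card (fun v => label v == u)); congr (mu (event _)).
  by apply/funext => b; rewrite /label restr_restr.
have GE := mu_dist (mE u) mG.
(* [perm_fill] makes [PD] and [G] nested, so their symmetric difference is measured by the
   difference of [mu PD = mu (E u)] and [mu G]. *)
have PDG : mu (G `+` PD) < e / 2.
  apply: le_lt_trans EG; apply: le_trans GE; have [fill|fill] := Pfill u.
    have sub : PD `<=` G.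
      by move=> x [x01 /eqP lx]; split => //; have := fill _ lx; rewrite permKV.
    rewrite (_ : G `+` PD = G `\` PD); last first.
      by apply/seteqP; split => x; [move=> [//|[/sub]]|left].
    by rewrite mu_setD// PDE distrC; exact: ler_norm.
  have sub : G `<=` PD.
    move=> x [x01 gx]; split => //; apply/eqP/fill; by rewrite permKV.
  rewrite (_ : G `+` PD = PD `\` G); last first.
    by apply/seteqP; split => x; [move=> [[/sub]//|//]|right].
  by rewrite mu_setD// PDE; exact: ler_norm.
apply: le_lt_trans (mu_setY_tri (mE u) mG mPD) _.
by rewrite [e in _ < e](splitr e) ltrD.
Qed.

(** Summing the errors over all [2 ^ N] cylinders gives one permutation that serves every [D]. *)
Lemma dyadic_permutation N e : 0 < e -> exists M, (N <= M)%N /\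
  exists P : {perm {ffun 'I_M -> bool}}, forall D : {ffun 'I_N -> bool} -> bool,
    mu ((T @` event (fun b => D (restr N b))) `+`
      event (fun b => D (restr N (extend ((P^-1)%g (restr M b)))))) < e.
Proof.
move=> e0; pose d : R := e / (2 ^ N)%:R.
have d0 : 0 < d by rewrite divr_gt0// ltr0n expn_gt0.
have [M [leNM [P HP]]] := dyadic_permutation_cylinders N d0.
exists M; split => //; exists P => D.
pose label (v : {ffun 'I_M -> bool}) := restr N (extend v).
pose PD u := event (fun b => label ((P^-1)%g (restr M b)) == u).
have mPD (Q : {ffun 'I_N -> bool} -> bool) :
    measurable (event (fun b => Q (label ((P^-1)%g (restr M b))))).
  exact: (measurable_restr (fun v => Q (label ((P^-1)%g v)))).
have mY u : measurable ((T @` cyl u) `+` PD u).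
  by apply: measurableY; [exact: (measurable_T (pred1 u))|exact: (mPD (pred1 u))].
apply: (@le_lt_trans _ _ (mu (\big[setU/set0]_u ((T @` cyl u) `+` PD u)))).
  apply: mu_le; first by apply: measurableY => //; exact: mPD.
    by apply: bigsetU_measurable => u _; exact: mY.
  move=> x [[[y [y01 Dy] <-] nD]|[[x01 Dx] nT]].
    apply: (@sub_bigsetU _ _ (restr N (digit y))); left; split.
      by exists y => //; split.
    by move=> [x01 /eqP lx]; apply: nD; split => //; rewrite -/(label _) lx.
  apply: (@sub_bigsetU _ _ (label ((P^-1)%g (restr M (digit x))))); right.
  split; first by split.
  move=> [y [y01 /eqP ly] Ty]; apply: nT; exists y => //; split => //.
  by rewrite ly.
apply: le_lt_trans (mu_bigsetU _ _ _) _ => //.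
have -> : e = \sum_(u : {ffun 'I_N -> bool}) d.
  by rewrite sumr_const card_bits -(mulr_natr d) /d mulfVK// pnatr_eq0 expn_eq0.
apply: ltr_sum => [|u _]; last exact: HP.
by apply/hasP; exists [ffun=> false]; rewrite ?mem_index_enum.
Qed.

Lemma dyadic_approximation_seq (s : seq (set R)) e : 0 < e ->
  (forall A, A \in s -> measurable A) ->
  exists N, forall n, (N <= n)%N -> forall A, A \in s ->
    exists D : {ffun 'I_n -> bool} -> bool,
      mu (A `+` event (fun b => D (restr n b))) < e.
Proof.
move=> e0; elim: s => [|A s IH] ms; first by exists 0%N.
have [N1 H1] := dyadic_approximation (ms A (mem_head _ _)) e0.
have [B Bs|N2 H2] := IH; first by apply: ms; rewrite in_cons Bs orbT.
exists (maxn N1 N2) => n; rewrite geq_max => /andP[le1 le2] B.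
rewrite in_cons => /orP[/eqP ->|Bs]; first exact: H1.
exact: H2.
Qed.

(** Three approximations are chained: [A] by a dyadic [B], the [T]-image of [B] by a permuted dyadic
    set [C], and [C] by the image of [B] under the model. The first is paid twice, for a total below
    [e / 2]. *)
Lemma model_transformation_dense (s : seq (set R)) e : 0 < e ->
  (forall A, A \in s -> measurable A /\ A `<=` unit_itv) ->
  exists N m (P P' : {ffun 'I_N -> bool} -> {ffun 'I_N -> bool})
    (PK : cancel P P') (PK' : cancel P' P), (0 < m)%N /\
    forall A, A \in s ->
      mu ((model_transformation R m PK PK' @` A) `+` (T @` A)) < e.
Proof.
move=> e0 ms; have e80 : 0 < e / 8 by rewrite divr_gt0.
have [//|N HN] := @dyadic_approximation_seq s _ e80; first by move=> A /ms[].
have [M [leNM [P HP]]] := dyadic_permutation N e80.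
have [m0 Hm] := hX_lt e80; pose m := m0.+1.
have hm : 2^-1 ^+ m < e / 8 by apply: le_lt_trans Hm; exact: hX_le.
exists M, m, P, (P^-1)%g, (permK P), (permKV P); split => // A As.
have [mA AI] := ms _ As; have [D HD] := HN N (leqnn N) A As.
set S := model_transformation _ _ _ _.
pose Q (v : {ffun 'I_M -> bool}) := D (restr N (extend v)).
have close := model_transformation_close R m (permK P) (permKV P) Q.
have EB : event (fun b => Q (restr M b)) = event (fun b => D (restr N b)).
  by congr event; apply/funext => b; rewrite /Q restr_restr.
pose B := event (fun b => D (restr N b)).
have mB : measurable B by exact: (measurable_restr D).
have BI : B `<=` unit_itv by exact: event_unit_itv.
pose C := event (fun b => Q ((P^-1)%g (restr M b))).
have mC : measurable C by exact: (measurable_restr (fun v => Q ((P^-1)%g v))).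
have TBC : mu (C `+` (T @` B)) < e / 8 by rewrite setYC; exact: HP D.
have SBC : mu ((S @` B) `+` C) < e / 8.
  by rewrite /B -EB; exact: le_lt_trans close hm.
apply: le_lt_trans (mu_image_setY_tri S T mA mB AI BI) _.
have mSB : measurable (S @` B) by exact: measurable_image.
have := mu_setY_tri mSB mC (measurable_image T mB BI).
by rewrite -/B in HD; lra.
Qed.

End halmos.

(** * Neighbourhoods in the weak topology *)

Lemma nbhs_mptrans_subbase (R : realType) (c : mptrans R) (O : set (mptrans R)) : 
  nbhs c O -> exists D : seq (set (mptrans R)), 
   (forall N, N \in D -> weak_subbase N) /\
   (forall N, N \in D -> N c) /\ (forall d, (forall N, N \in D -> N d) -> O d).
Proof.
rewrite nbhsE => -[B [oB Bc] BO].
move: oB => [D' D'fin D'B].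
move: Bc; rewrite -D'B => -[C D'C Cc]; have [F FS FC] := D'fin _ D'C.
exists (finmap.enum_fset F : seq (set (mptrans R))); split.
  by move=> N NF; have := FS _ NF; rewrite inE.
split.
  by move=> N NF; move: Cc; rewrite -FC; apply.
move=> d Hd; apply: BO; rewrite -D'B; exists C => //.
by change (C d); rewrite -FC => N /= NF; exact: Hd.
Qed.

Lemma open_weak_nbhd (R : realType) (T : transformation R) (A : set R) e :
  measurable A -> A `<=` `[0, 1[%classic -> 0 < e -> open (weak_nbhd T A e).
Proof.
move=> mA A01 e0.
exists [set weak_nbhd T A e]; last by rewrite bigcup_set1.
move=> _ ->.
apply: finI_from1 => /=.
by exists T, A, e.
Qed.

Lemma eq_pi_ae (R : realType) (S T : transformation R) :
  \pi_(mptrans R) S = \pi_(mptrans R) T <->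
  ae_eq lebesgue_measure unit_itv S T.
Proof.
split=> [/eqquotP/asboolP|h]; first by [].
by apply/eqquotP/asboolP.
Qed.

Section weak_topology.
Variable R : realType.
Implicit Types (S T : transformation R) (A B C : set R) (c : mptrans R).

Lemma mu_image_setY_ae S T V A :
  \pi_(mptrans R) S = \pi_(mptrans R) V -> measurable A -> A `<=` unit_itv ->
  mu ((S @` A) `+` (T @` A)) = mu ((V @` A) `+` (T @` A)).
Proof.
move=> SV mA AI; have mI W : measurable ((W : transformation R) @` A).
  exact: measurable_image.
have le W W' : \pi_(mptrans R) W = \pi_(mptrans R) W' ->
    mu ((W @` A) `+` (T @` A)) <= mu ((W' @` A) `+` (T @` A)).
  move=> WW'; apply: le_trans (mu_setY_tri (mI W) (mI W') (mI T)) _.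
  by rewrite ae_eq_image ?add0r//; apply/eq_pi_ae.
by apply/eqP; rewrite eq_le !le.
Qed.

Lemma near_image T A e : measurable A -> A `<=` unit_itv -> 0 < e ->
  \forall c \near \pi_(mptrans R) T, forall S, \pi_(mptrans R) S = c ->
    mu ((S @` A) `+` (T @` A)) < e.
Proof.
(* The subbase only tests subsets of [[0,1)]; removing the point 1 changes no measure. *)
move=> mA AI e0; pose A' := A `\ 1.
have mA' : measurable A' by exact: measurableD.
have A'I : A' `<=` unit_itv by move=> x [/AI].
have A'1 : A' `<=` `[0, 1[%classic.
  move=> x [/AI xI x1] /=; rewrite in_itv/=.
  by have [//|] := unit_itv_cases xI.
have muAA' : mu (A `+` A') = 0.
  apply/eqP; rewrite eq_le mu_ge0 andbT -(mu_set1 (1 : R)).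
  apply: mu_le => //; first exact: measurableY.
  by move=> x [[Ax nA']|[[Ax _] //]]; apply: contrapT => x1; exact: nA'.
have oN := open_weak_nbhd T mA' A'1 e0.
have TN : nbhs (\pi_(mptrans R) T) (weak_nbhd T A' e).
  apply: open_nbhs_nbhs; split => //.
  by exists T => //=; rewrite setYK measure0 lte_fin.
apply: filterS TN => c [V /= VT <-] S SV.
rewrite (mu_image_setY_ae T SV mA AI).
apply: le_lt_trans (mu_image_setY_tri V T mA mA' AI A'I) _.
rewrite muAA' mulr0 addr0 -lte_fin -lambda_muS//.
  by apply: measurableY; exact: measurable_image.
by move=> x [[Vx _]|[Tx _]]; [apply: image_sub_unit_itv Vx|apply: image_sub_unit_itv Tx].
Qed.

Lemma near_iter_image T B k e : measurable B -> B `<=` unit_itv -> 0 < e ->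
  \forall c \near \pi_(mptrans R) T, forall S, \pi_(mptrans R) S = c ->
    mu ((iter k S @` B) `+` (iter k T @` B)) < e.
Proof.
move=> mB BI e0; pose d := e / k.+1%:R; have d0 : 0 < d by rewrite divr_gt0.
have near_l (l : 'I_k) : \forall c \near \pi_(mptrans R) T,
    forall S, \pi_(mptrans R) S = c ->
    mu ((S @` (iter l T @` B)) `+` (T @` (iter l T @` B))) < d.
  apply: near_image => //.
    exact: (@measurable_image R (iter_transformation T l)).
  exact: (@image_sub_unit_itv R (iter_transformation T l)).
apply: filterS (filter_forall _ near_l) => c Hc S Sc.
apply: le_lt_trans (mu_iter_image_le S T k mB BI) _.
apply: (@le_lt_trans _ _ (\sum_(l < k) d)).
  by apply: ler_sum => l _; apply/ltW/Hc.
rewrite sumr_const card_ord -(mulr_natr d) /d -mulrA gtr_pMr//.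
by rewrite mulrC ltr_pdivrMr// mul1r ltr_nat.
Qed.

Lemma ae_iter_image S T B k : \pi_(mptrans R) S = \pi_(mptrans R) T ->
  measurable B -> B `<=` unit_itv ->
  mu ((iter k S @` B) `+` (iter k T @` B)) = 0.
Proof.
move=> /eq_pi_ae ST mB BI; apply/eqP; rewrite eq_le mu_ge0 andbT.
apply: le_trans (mu_iter_image_le S T k mB BI) _.
rewrite big1// => l _; apply: ae_eq_image => //.
  exact: (@measurable_image R (iter_transformation T l)).
exact: (@image_sub_unit_itv R (iter_transformation T l)).
Qed.

(** Each of the finitely many subbasic sets around the class of [T] is recentred at [T], its radius
    reduced by the distance between the images of [A] under [T] and under its centre [T']. *)
Lemma nbhs_mptrans_images T (O : set (mptrans R)) : nbhs (\pi_(mptrans R) T) O ->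
  exists (s : seq (set R)) (e : R), [/\ 0 < e,
    forall A, A \in s -> measurable A /\ A `<=` unit_itv &
    forall S, (forall A, A \in s -> mu ((S @` A) `+` (T @` A)) < e) ->
      O (\pi_(mptrans R) S)].
Proof.
move=> /nbhs_mptrans_subbase[D [subD [DT DO]]].
suff [s [e [e0 ms Hs]]] : exists (s : seq (set R)) (e : R), [/\ 0 < e,
    forall A, A \in s -> measurable A /\ A `<=` unit_itv &
    forall S, (forall A, A \in s -> mu ((S @` A) `+` (T @` A)) < e) ->
      forall N, N \in D -> N (\pi_(mptrans R) S)].
  by exists s, e; split => // S /Hs HS; exact: DO.
elim: D subD DT {DO} => [_ _|N D IH subD DT]; first by exists [::], 1.
have [||s [e [e0 ms Hs]]] := IH.
- by move=> N' N'D; apply: subD; rewrite in_cons N'D orbT.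
- by move=> N' N'D; apply: DT; rewrite in_cons N'D orbT.
have [T' [A [e' [mA A01 e'0 NE]]]] := subD N (mem_head _ _).
have AI : A `<=` unit_itv.
  move=> x /A01 /=; rewrite in_itv/= => /andP[x0 /ltW x1].
  by apply/unit_itvE; rewrite x0.
have mI W : measurable ((W : transformation R) @` A) by exact: measurable_image.
have lamE (W W' : transformation R) :
    lambda ((W @` A) `+` (W' @` A)) = (mu ((W @` A) `+` (W' @` A)))%:E.
  apply: lambda_muS; first exact: measurableY (mI W) (mI W').
  by move=> x [[Vx _]|[Tx _]]; [apply: image_sub_unit_itv Vx|apply: image_sub_unit_itv Tx].
have TT' : mu ((T @` A) `+` (T' @` A)) < e'.
  have := DT N (mem_head _ _); rewrite NE => -[V /= + VT].
  by rewrite lamE lte_fin (mu_image_setY_ae T' VT).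
pose d := e' - mu ((T @` A) `+` (T' @` A)).
have d0 : 0 < d by rewrite subr_gt0.
exists (A :: s), (Num.min e d); split => [||S HS N'].
- by rewrite lt_min e0.
- by move=> B; rewrite in_cons => /orP[/eqP ->//|/ms].
rewrite in_cons => /orP[/eqP ->|]; last first.
  apply: Hs => B Bs; have := HS B; rewrite in_cons Bs orbT => /(_ isT).
  by rewrite lt_min => /andP[].
rewrite NE; exists S => //=; rewrite lamE lte_fin.
apply: le_lt_trans (mu_setY_tri (mI S) (mI T) (mI T')) _.
have := HS A (mem_head _ _); rewrite lt_min => /andP[_].
by rewrite /d ltrBrDr.
Qed.

End weak_topology.

(** * Mixing windows *)

Lemma increasing_nat_ge f : increasing_nat f -> forall n, (n <= f n)%N.
Proof.
by move=> f_incr; elim=> // n IH; apply: leq_ltn_trans IH _; exact: f_incr.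
Qed.

Lemma enumerate_infinite (J : set nat) : (forall n, exists2 k, (n <= k)%N & J k) ->
  exists a : nat -> nat, [/\ increasing_nat a, forall i, J (a i) &
    forall k, J k -> exists i, a i = k].
Proof.
move=> Jinf.
have ex n : exists k, (n <= k)%N && `[< J k >].
  by have [k lek /asboolP Jk] := Jinf n; exists k; rewrite lek.
pose next n := ex_minn (ex n).
have nextP n : [/\ (n <= next n)%N, J (next n) &
    forall k, (n <= k)%N -> J k -> (next n <= k)%N].
  rewrite /next; case: ex_minnP => k /andP[lek /asboolP Jk] kmin; split => // l lel Jl.
  by apply: kmin; rewrite lel; exact/asboolP.
pose a := fix a i := if i is i'.+1 then next (a i').+1 else next 0%N.
have aS i : (a i < a i.+1)%N by have [] := nextP (a i).+1.
have a_incr : increasing_nat a by exact: (homo_ltn ltn_trans aS).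
exists a; split => // [[|i]|k Jk]; [by case: (nextP 0%N)|by case: (nextP (a i).+1)|].
(* The first [i] with [k <= a i] works: [a i] is the least element of [J] beyond the preceding term,
   and [k] is such an element. *)
have exk : exists i, (k <= a i)%N by exists k; exact: increasing_nat_ge.
case: (ex_minnP exk) => i leki imin; exists i; apply/eqP; rewrite eqn_leq leki andbT.
case: i leki imin => [|i] leki imin; first by have [_ _] := nextP 0%N; apply.
have [_ _] := nextP (a i).+1; apply => //.
by rewrite ltnNge; apply/negP => /imin; rewrite ltnn.
Qed.

Section generic_mixing.
Variables (R : realType) (f : nat -> nat).
Implicit Types (S T : transformation R) (A B : set R) (c : mptrans R).

Lemma mu_setI_dist A B A' B' : measurable A -> measurable B -> measurable A' ->
  measurable B' ->
  `|mu (A `&` B) - mu (A' `&` B')| <= mu (A `+` A') + mu (B `+` B').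
Proof.
move=> mA mB mA' mB'.
apply: le_trans (mu_dist (measurableI _ _ mA mB) (measurableI _ _ mA' mB')) _.
have mAA := measurableY mA mA'; have mBB := measurableY mB mB'.
apply: le_trans (muU_le mAA mBB); apply: mu_le.
- by apply: measurableY; exact: measurableI.
- exact: measurableU.
move=> x /= [[[Ax Bx] n]|[[Ax Bx] n]].
  by have [A'x|nA'x] := pselect (A' x); [right; left; split => // B'x; exact: n|left; left].
by have [A'x|nA'x] := pselect (A x); [right; right; split => // B'x; exact: n|left; right].
Qed.

Definition dyadic n (D : {ffun {ffun 'I_n -> bool} -> bool}) : set R :=
  @event R (fun b => D (restr n b)).

Lemma measurable_dyadic n D : measurable (@dyadic n D).
Proof. exact: finitary_measurable (finitary_restr D). Qed.

Lemma dyadic_unit_itv n D : @dyadic n D `<=` unit_itv.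
Proof. exact: event_unit_itv. Qed.

Local Hint Resolve measurable_dyadic dyadic_unit_itv : core.

Lemma measurable_iter_image T k B : measurable B -> B `<=` unit_itv ->
  measurable (iter k T @` B).
Proof. exact: (@measurable_image R (iter_transformation T k)). Qed.

(** Only finitely many pairs are tested, with strict inequalities, so that the condition is weakly
    open. Images stand for preimages through [lambda_preimage_image]. *)
Definition mixes n k T := forall D D' : {ffun {ffun 'I_n -> bool} -> bool},
  `|mu (dyadic D `&` iter k T @` dyadic D') - mu (dyadic D) * mu (dyadic D')|
  < n.+1%:R^-1.

Lemma mixes_dist S T k A B : measurable A -> measurable B -> B `<=` unit_itv ->
  `|mu (A `&` iter k S @` B) - mu (A `&` iter k T @` B)| <=
  mu ((iter k S @` B) `+` (iter k T @` B)).
Proof.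
move=> mA mB BI; have mI V := measurable_iter_image V k mB BI.
apply: le_trans (mu_setI_dist mA (mI S) mA (mI T)) _.
by rewrite setYK [mu set0](_ : _ = 0) ?add0r// /mu set0I measure0.
Qed.

Lemma mixes_ae n k S T : \pi_(mptrans R) S = \pi_(mptrans R) T ->
  mixes n k S -> mixes n k T.
Proof.
move=> ST mS D D'; have := mixes_dist S T k (@measurable_dyadic n D)
  (@measurable_dyadic n D') (@dyadic_unit_itv n D').
by rewrite ae_iter_image// normr_le0 subr_eq0 => /eqP <-; exact: mS.
Qed.

Definition mixing_window n : set (mptrans R) :=
  \bigcup_(j in [set j | (n <= j)%N])
    [set c | forall k, (j <= k <= f j)%N ->
      forall T, \pi_(mptrans R) T = c -> mixes n k T].

(** Each strict inequality leaves a positive slack [d], and a small change of the [k]-th iterates of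
    the finitely many dyadic sets stays within it. *)
Lemma near_mixes n k T : mixes n k T ->
  \forall c \near \pi_(mptrans R) T, forall S, \pi_(mptrans R) S = c -> mixes n k S.
Proof.
move=> mT; pose d D D' := n.+1%:R^-1 -
  `|mu (dyadic D `&` iter k T @` @dyadic n D') - mu (@dyadic n D) * mu (dyadic D')|.
have d0 D D' : 0 < d D D' by rewrite subr_gt0; exact: mT.
have H (DD : {ffun {ffun 'I_n -> bool} -> bool} *
              {ffun {ffun 'I_n -> bool} -> bool}) :
    \forall c \near \pi_(mptrans R) T, forall S, \pi_(mptrans R) S = c ->
    mu ((iter k S @` dyadic DD.2) `+` (iter k T @` dyadic DD.2)) < d DD.1 DD.2.
  exact: near_iter_image.
apply: filterS (filter_forall _ H) => c Hc S Sc D D'.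
have := Hc (D, D') S Sc; rewrite /= /d ltrBrDr; apply: le_lt_trans.
have := mixes_dist S T k (@measurable_dyadic n D) (@measurable_dyadic n D')
  (@dyadic_unit_itv n D').
move=> le; apply: (le_trans _ (lerD le (lexx _))).
exact: ler_distD.
Qed.

Lemma open_mixing_window n : open (mixing_window n).
Proof.
apply: bigcup_open => j lenj; rewrite openE => c Hc.
rewrite /interior -(reprK c).
have H (k : 'I_(f j).+1) : \forall c' \near \pi_(mptrans R) (repr c),
    (j <= k)%N -> forall S, \pi_(mptrans R) S = c' -> mixes n k S.
  have [lejk|nle] := boolP (j <= k)%N; last first.
    by apply: filterS filterT => c' _.
  have mk : mixes n k (repr c) by apply: Hc; rewrite ?reprK// lejk -ltnS ltn_ord.
  by apply: filterS (near_mixes mk) => c' Hc' _.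
apply: filterS (filter_forall _ H) => c' Hc' k /andP[lejk lekf].
exact: (Hc' (Ordinal (lekf : (k < (f j).+1)%N)) lejk).
Qed.

Lemma mixing_window_dense : dense (\bigcap_n mixing_window n).
Proof.
move=> O [c Oc] oO; have nO : nbhs (\pi_(mptrans R) (repr c)) O.
  by rewrite reprK; exact: open_nbhs_nbhs.
have [s [e [e0 ms HO]]] := nbhs_mptrans_images nO.
have [N [m [P [P' [PK [PK' [m0 close]]]]]]] :=
  model_transformation_dense (repr c) e0 ms.
set S := model_transformation R m PK PK' in close.
exists (\pi_(mptrans R) S); split; first exact: HO.
move=> n _.
have H (DD : {ffun {ffun 'I_n -> bool} -> bool} *
              {ffun {ffun 'I_n -> bool} -> bool}) :=
  @model_transformation_mixing R N m P P' PK PK' n (fun b => DD.1 (restr n b))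
   (fun b => DD.2 (restr n b)) n.+1%:R^-1 m0 (determined_restr DD.1)
   (determined_restr DD.2) ltac:(by rewrite invr_gt0).
have [n0 Hn0] := choice H.
(* From this exponent on the model passes all finitely many tests, so a window may start here
   whatever its length. *)
exists (maxn n (\max_DD n0 DD)) => /=; first exact: leq_maxl.
move=> k /andP[lek _] T TS; apply: mixes_ae (esym TS) _ => D D'.
have lek0 : (n0 (D, D') <= k)%N.
  by apply: leq_trans lek; apply: leq_trans (leq_maxr _ _); exact: leq_bigmax.
have := Hn0 (D, D') k lek0; rewrite -/S /= -!/(dyadic _).
rewrite (_ : mu (_ `&` _) = mu (dyadic D `&` iter k S @` dyadic D'))//.
rewrite /mu setIidl; last by move=> x [_ /dyadic_unit_itv].
rewrite (@lambda_preimage_image R (iter_transformation S k))//.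
Qed.

(** Passing to the dyadic sets costs the two distances once in the intersection and once in the
    product, hence the factors 2. *)
Lemma mixes_approx n k T A B D D' : mixes n k T -> measurable A ->
  measurable B -> A `<=` unit_itv -> B `<=` unit_itv ->
  `|mu (A `&` iter k T @` B) - mu A * mu B| <=
  2 * mu (A `+` @dyadic n D) + 2 * mu (B `+` @dyadic n D') + n.+1%:R^-1.
Proof.
move=> /(_ D D') mix mA mB AI BI.
have mD := @measurable_dyadic n D; have mD' := @measurable_dyadic n D'.
have DI := @dyadic_unit_itv n D; have D'I := @dyadic_unit_itv n D'.
have := mu_setI_dist mA (measurable_iter_image T k mB BI) mD
  (measurable_iter_image T k mD' D'I).
rewrite (@mu_image_setY R (iter_transformation T k))// => d1.
have d2 := mu_dist mA mD; have d3 := mu_dist mB mD'.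
have le1 (C : set R) : measurable C -> C `<=` unit_itv -> `|mu C| <= 1.
  move=> mC CI; rewrite ger0_norm ?mu_ge0//.
  by apply: le_trans (mu_le mC (@measurable_unit_itv R) CI) _; rewrite mu_unit_itv.
have d4 : `|mu (dyadic D) * mu (dyadic D') - mu A * mu B| <=
    mu (A `+` dyadic D) + mu (B `+` dyadic D').
  rewrite (_ : _ - _ = (mu (dyadic D) - mu A) * mu (dyadic D') +
    mu A * (mu (dyadic D') - mu B)); last by ring.
  apply: le_trans (ler_normD _ _) _; rewrite !normrM lerD//.
    by rewrite distrC; apply: le_trans d2; rewrite ler_piMr// le1.
  by rewrite distrC; apply: le_trans d3; rewrite ler_piMl// le1.
move: d1 mix d4 {d2 d3}; rewrite !ler_norml !ltr_norml; move: (n.+1%:R^-1) => z.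
by move=> /andP[? ?] /andP[? ?] /andP[? ?]; apply/andP; split; lra.
Qed.

Lemma window_mixing_sequence c : increasing_nat f -> (\bigcap_n mixing_window n) c ->
  exists a, [/\ increasing_nat a, thick f a & mixing_sequence a c].
Proof.
move=> f_incr Hc; have H n : exists j, (n <= j)%N /\ forall k, (j <= k <= f j)%N ->
    forall T, \pi_(mptrans R) T = c -> mixes n k T.
  by have [j lenj Hj] := Hc n Logic.I; exists j.
have [j jP] := choice H.
(* The union of one window for each precision; its increasing enumeration is the mixing sequence. *)
pose J : set nat := [set k | exists n, (j n <= k <= f (j n))%N].
have Jinf n : exists2 k, (n <= k)%N & J k.
  exists (j n); first by have [] := jP n.
  by exists n; rewrite leqnn increasing_nat_ge.
have [a [a_incr aJ Ja]] := enumerate_infinite Jinf.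
exists a; split => // [n|T Tc A B mA mB AI BI].
  exists (j n) => [|k lek]; first by have [] := jP n.
  by apply: Ja; exists n.
have E k := @lambda_preimage_image R (iter_transformation T k) _ _ mA mB AI BI.
under eq_fun do rewrite E.
rewrite (lambda_muS mA AI) (lambda_muS mB BI) -EFinM.
apply/fine_cvgP; split; first exact: nearW.
apply/cvgrPdist_lt => e e0; have e80 : 0 < e / 8 by rewrite divr_gt0.
have [NA HA] := dyadic_approximation mA e80.
have [NB HB] := dyadic_approximation mB e80.
have [n0 _ Hn0] := near_infty_natSinv_lt (PosNum e80).
pose n1 := maxn (maxn NA NB) n0.
(* The windows of index below [n1] end before this value, and [i <= a i], so [a i] lies in a window
   of index at least [n1]. *)
exists (\max_(n < n1) f (j n)).+1 => // i /= lei.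
have [n /andP[jn nf]] := aJ i.
have len1 : (n1 <= n)%N.
  rewrite leqNgt; apply/negP => ltn; move: nf; apply/negP; rewrite -ltnNge.
  apply: (@leq_trans i); last exact: increasing_nat_ge.
  by apply: leq_trans lei; rewrite ltnS (leq_bigmax (Ordinal ltn)).
have [PA HPA] := HA n ltac:(by move: len1; rewrite !geq_max -andbA => /andP[]).
have [PB HPB] := HB n ltac:(by move: len1; rewrite !geq_max -andbA => /and3P[]).
have dE (P : {ffun 'I_n -> bool} -> bool) :
    dyadic [ffun v => P v] = @event R (fun b => P (restr n b)).
  by congr (event _); apply/funext => b; rewrite ffunE.
rewrite -dE in HPA; rewrite -dE in HPB.
have mix := (jP n).2 (a i) ltac:(by rewrite jn) T Tc.
have := Hn0 n ltac:(by move: len1; rewrite !geq_max => /andP[]).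
rewrite distrC /= => hn.
apply: le_lt_trans (mixes_approx [ffun v => PA v] [ffun v => PB v] mix mA mB AI BI) _.
move: HPA HPB hn; move: (mu (A `+` _)) (mu (B `+` _)) (n.+1%:R^-1) => x y z.
lra.
Qed.

End generic_mixing.

Theorem proposition1p4 (R : realType) (f : nat -> nat)
    (f_incr : increasing_nat f) :
  exists G : set (mptrans R), residual G /\
    forall T : mptrans R, G T ->
      exists a : nat -> nat,
        [/\ increasing_nat a, thick f a & mixing_sequence a T].
Proof.
exists (\bigcap_n mixing_window f n); split; last first.
  by move=> c; exact: window_mixing_sequence f_incr.
exists (\bigcap_n mixing_window f n); split => //.
- by exists (@mixing_window R f) => // n; exact: open_mixing_window.
- exact: mixing_window_dense.
Qed.
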